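(* Let $$\varphi_{RL}(z):=\sqrt{2}-(\sqrt{2}-1)\sqrt{\frac{1-z}{1+2(\sqrt{2}-1)z}},\qquad z\in\mathbb{D},$$ $$g_0(z):=\sqrt{2(\sqrt{2}-1)}\;\tan^{-1}\left(\frac{\sqrt{2(\sqrt{2}-1)}\left(\sqrt{2(\sqrt{2}-1)z+1}-\sqrt{1-z}\right)}{2(\sqrt{2}-1)\sqrt{1-z}+\sqrt{2(\sqrt{2}-1)z+1}}\right),$$ and $\varphi_{Ne}(z):=1+z-z^3/3$. Let $\beta\in\mathbb{R}$. Then, for $p\in\mathcal{H}$ satisfying $p(0)=1$, each of the following differential subordinations is sufficient to imply $p\prec\varphi_{Ne}$: (a) $1+\beta zp'(z)\prec\varphi_{RL}(z)$, for $\beta\geq-\dfrac{3}{2}\left(2(\sqrt{2}-1)\log\left(\dfrac12\left(\sqrt{1-2(\sqrt{2}-1)}+\sqrt{2}\right)\right)+g_0(-1)\right)\approx0.822832$; (b) $1+\beta\,\dfrac{zp'(z)}{p(z)}\prec\varphi_{RL}(z)$, for $\beta\geq\dfrac{2(\sqrt{2}-1)\log\left(\frac12\sqrt{2(\sqrt{2}-1)+1}\right)+g_0(1)}{\log(5/3)}\approx0.680906$; (c) $1+\beta\,\dfrac{zp'(z)}{p^2(z)}\prec\varphi_{RL}(z)$, for $\beta\geq\dfrac52\left(2(\sqrt{2}-1)\log\left(\frac12\sqrt{2(\sqrt{2}-1)+1}\right)+g_0(1)\right)\approx0.869561$. Moreover, the respective bounds on $\beta$ cannot be improved further.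
   Context: $\mathbb{D}=\{z\in\mathbb{C}:|z|<1\}$ and $\mathcal{H}$ is the set of all analytic functions on $\mathbb{D}$. For $f,g\in\mathcal{H}$, $f\prec g$ ($f$ is subordinate to $g$) means that there is $w\in\mathcal{H}$ with $w(0)=0$ and $|w(z)|<1$ for $z\in\mathbb{D}$ such that $f(z)=g(w(z))$ on $\mathbb{D}$; in particular, writing a subordination presupposes that both sides are analytic in $\mathbb{D}$. Square roots are principal branches (so $\varphi_{RL}(0)=1$), $\tan^{-1}$ is the principal arctangent, and $\log$ of a positive number is the natural logarithm. That a bound $\beta\ge\beta_0$ cannot be improved means that $\beta_0$ cannot be replaced by any smaller real number so that the implication remains valid for all such $p$ and all $\beta$ at least that number. *)

(* Defs.v *)
From Stdlib Require Import Reals Lra.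
From Coquelicot Require Import Coquelicot.

Open Scope R_scope.

Definition unit_disk (z : C) : Prop := Cmod z < 1.

(* Functions on the disk are represented by total functions C -> C whose values
   outside the disk are irrelevant; differentiability is over C, so on
   the disk [C_derive f] is the complex derivative (see [C_derive_correct]). *)
Definition analytic_on_disk (f : C -> C) : Prop :=
  forall z : C, unit_disk z -> @ex_derive C_AbsRing C_NormedModule f z.

(* Since division is total, analyticity of [f] is what excludes, e.g.,
   [f z = 1 + beta * (z * p' z / p z)] (beta <> 0) when p has a zero in the disk:
   there z p'/p is unbounded nearby. *)
Definition subordinate (f g : C -> C) : Prop :=
  analytic_on_disk f /\ analytic_on_disk g /\
  exists w : C -> C,
    analytic_on_disk w /\
    w (RtoC 0) = RtoC 0 /\
    (forall z : C, unit_disk z -> Cmod (w z) < 1) /\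
    (forall z : C, unit_disk z -> f z = g (w z)).

(* Principal square root: nonnegative real part, and nonnegative imaginary part
   on the cut (-oo, 0). *)
Definition Csqrt (z : C) : C :=
  (sqrt ((Cmod z + Re z) / 2),
   if Rlt_dec (Im z) 0 then - sqrt ((Cmod z - Re z) / 2)
   else sqrt ((Cmod z - Re z) / 2)).

Lemma Csqrt_sqr (z : C) : (Csqrt z * Csqrt z)%C = z.
Proof.
destruct z as [x y].
assert (Hm : Cmod (x, y) * Cmod (x, y) = x * x + y * y).
{ unfold Cmod; rewrite sqrt_sqrt; simpl; nra. }
assert (H0 := Cmod_ge_0 (x, y)).
unfold Csqrt; simpl Re; simpl Im.
set (m := Cmod (x, y)) in *.
assert (Hp : 0 <= (m + x) / 2) by nra.
assert (Hq : 0 <= (m - x) / 2) by nra.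
assert (Hpq : sqrt ((m + x) / 2) * sqrt ((m - x) / 2) = Rabs y / 2).
{ rewrite <- sqrt_mult by assumption.
  replace ((m + x) / 2 * ((m - x) / 2)) with (Rsqr (y / 2)) by (unfold Rsqr; nra).
  rewrite sqrt_Rsqr_abs; unfold Rdiv; rewrite Rabs_mult.
  rewrite (Rabs_pos_eq (/ 2)); lra. }
assert (Hp2 := sqrt_sqrt _ Hp).
assert (Hq2 := sqrt_sqrt _ Hq).
unfold Cmult; simpl.
destruct (Rlt_dec y 0) as [Hy | Hy]; apply injective_projections; simpl;
  try nra.
- rewrite Rabs_left in Hpq by assumption; nra.
- rewrite Rabs_pos_eq in Hpq by lra; nra.
Qed.

Lemma Csqrt_principal (z : C) :
  0 <= Re (Csqrt z) /\ (Re (Csqrt z) = 0 -> 0 <= Im (Csqrt z)).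
Proof.
split; [apply sqrt_pos | intros H].
unfold Csqrt in *; simpl in *.
destruct (Rlt_dec (Im z) 0) as [Hy | Hy]; [exfalso | apply sqrt_pos].
revert H Hy; destruct z as [x y]; simpl; intros H Hy.
assert (Hm : Cmod (x, y) * Cmod (x, y) = x * x + y * y).
{ unfold Cmod; rewrite sqrt_sqrt; simpl; nra. }
assert (H0 := Cmod_ge_0 (x, y)).
apply sqrt_eq_0 in H; nra.
Qed.

Definition phi_RL (z : C) : C :=
  (sqrt 2 - (sqrt 2 - 1) * Csqrt ((1 - z) / (1 + 2 * (sqrt 2 - 1) * z)))%C.

Definition phi_Ne (z : C) : C := (1 + z - z ^ 3 / 3)%C.

(* Only the values at -1 and 1 are used; on the real interval [-1, 1] both
   radicands are nonnegative and the arctangent has a real argument. *)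
Definition g0 (x : R) : R :=
  sqrt (2 * (sqrt 2 - 1)) *
  atan (sqrt (2 * (sqrt 2 - 1)) *
          (sqrt (2 * (sqrt 2 - 1) * x + 1) - sqrt (1 - x)) /
        (2 * (sqrt 2 - 1) * sqrt (1 - x) + sqrt (2 * (sqrt 2 - 1) * x + 1))).

Definition beta_a : R :=
  - (3 / 2) *
  (2 * (sqrt 2 - 1) * ln (1 / 2 * (sqrt (1 - 2 * (sqrt 2 - 1)) + sqrt 2))
   + g0 (-1)).

Definition beta_b : R :=
  (2 * (sqrt 2 - 1) * ln (1 / 2 * sqrt (2 * (sqrt 2 - 1) + 1)) + g0 1)
  / ln (5 / 3).

Definition beta_c : R :=
  5 / 2 *
  (2 * (sqrt 2 - 1) * ln (1 / 2 * sqrt (2 * (sqrt 2 - 1) + 1)) + g0 1).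

Definition lhs_a (beta : R) (p : C -> C) (z : C) : C :=
  (1 + beta * (z * C_derive p z))%C.

Definition lhs_b (beta : R) (p : C -> C) (z : C) : C :=
  (1 + beta * (z * C_derive p z / p z))%C.

Definition lhs_c (beta : R) (p : C -> C) (z : C) : C :=
  (1 + beta * (z * C_derive p z / p z ^ 2))%C.

Definition sufficient_from (lhs : R -> (C -> C) -> C -> C) (beta0 : R) : Prop :=
  forall (beta : R) (p : C -> C),
    beta0 <= beta ->
    analytic_on_disk p -> p (RtoC 0) = RtoC 1 ->
    subordinate (lhs beta p) phi_RL ->
    subordinate p phi_Ne.

(* Main.v *)
(** Write h = phi_RL - 1 = a (1 - s) with a = sqrt 2 - 1, c = 2 a and
    s^2 = (1 - z) / (1 + c z).  Each hypothesis says beta z V'(z) = h(w(z)) with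
    V = p - 1, V = log p or V = 1 - 1/p, where |w(z)| <= |z| by Schwarz's lemma.
    The square root maps the disc with diameter [A^2, B^2] into the disc with
    diameter [A, B], so h maps |z| <= r into the disc with diameter [h(-r), h(r)].
    Integrating supporting half-planes along the ray from 0 to z, beta V(z) lies
    in the disc with diameter [Q(-|z|), Q(|z|)], where x Q'(x) = h(x).  For the
    stated beta this forces |p(z) - 1| < 2/3, and the disc |u| < 2/3 lies in the
    image of the unit disc under z - z^3/3, on which that map is injective.
    Sharpness comes from V = Q / beta, whose values at -1 and 1 give the three
    constants. *)
Require Import Defs.
From Stdlib Require Import Reals.
From Coquelicot Require Import Coquelicot.
From Stdlib Require Import Lra Lia Psatz ClassicalEpsilon.

(** * Complex derivatives *)

(** The number 2/3 is the distance from 1 to each of 1/3 and 5/3, the values of [phi_Ne] at -1 and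
    1, so |p - 1| < 2/3 describes the largest disc about 1 inside the image. In (a) the farther end
    of the disc for V decides, and since Q(1) <= -Q(-1) it is the end at -1. In (b) and (c) the
    value 5/3 of p corresponds to V = log(5/3) and V = 2/5, the value 1/3 only to -log 3 and -2;
    hence the end at 1 decides, and the slack at the other end is secured by numerical bounds.

    The obstacle in (b) and (c) is that V is under control only where p has no zero, and the
    principal logarithm only where Re p > 0. The estimate is therefore made along one segment on
    which Re p > 0; there it returns Re p > 1/3, and a continuity argument discharges the
    assumption. This is why every integration runs along a single ray and asks for V only on that
    ray.

    Schwarz's lemma rests on Goursat's bisection for closed real one-forms on rectangles. A
    rectangle in polar coordinates is an annulus cut along a ray, which yields circle means without
    any theory of contour integrals. *)

Definition cderiv (f : C -> C) (z l : C) : Prop :=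
  forall eps : R, 0 < eps -> exists d : R, 0 < d /\
    forall y : C, Cmod (y - z) < d ->
      Cmod (f y - f z - (y - z) * l) <= eps * Cmod (y - z).

Definition ccont (f : C -> C) (z : C) : Prop :=
  forall eps : R, 0 < eps -> exists d : R, 0 < d /\
    forall y : C, Cmod (y - z) < d -> Cmod (f y - f z) < eps.

Lemma cderiv_is_derive (f : C -> C) (z l : C) :
  cderiv f z l <-> @is_derive C_AbsRing C_NormedModule f z l.
Proof.
split.
- intros H; split; [apply is_linear_scal_l |].
  intros x Hx eps.
  rewrite <- (is_filter_lim_locally_unique _ _ Hx).
  destruct (H eps (cond_pos eps)) as [d [Hd Hy]].
  exists (mkposreal d Hd); intros y Hb.
  exact (Hy y Hb).
- intros [_ H] eps He.
  destruct (H z (fun P HP => HP) (mkposreal eps He)) as [d Hd].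
  exists d; split; [apply cond_pos |].
  intros y Hy; exact (Hd y Hy).
Qed.

(** The complex numbers carry two normed-module structures: the product rule, the identity and the
    inner function of a composition live over the ring's own module, whereas [C_derive] uses
    [C_NormedModule]. The epsilon-delta form [cderiv] is equivalent to both derivatives and so
    mediates between them. *)
Lemma cderiv_is_derive_ring (f : C -> C) (z l : C) :
  cderiv f z l <-> @is_derive C_AbsRing (AbsRing_NormedModule C_AbsRing) f z l.
Proof.
split.
- intros H; split; [apply is_linear_scal_l |].
  intros x Hx eps.
  rewrite <- (is_filter_lim_locally_unique _ _ Hx).
  destruct (H eps (cond_pos eps)) as [d [Hd Hy]].
  exists (mkposreal d Hd); intros y Hb.
  exact (Hy y Hb).
- intros [_ H] eps He.
  destruct (H z (fun P HP => HP) (mkposreal eps He)) as [d Hd].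
  exists d; split; [apply cond_pos |].
  intros y Hy; exact (Hd y Hy).
Qed.

Lemma cderiv_ext_loc (f g : C -> C) (z l r : C) (d : R) :
  0 < d -> (forall y, Cmod (y - z) < d -> f y = g y) ->
  l = r -> cderiv f z l -> cderiv g z r.
Proof.
intros Hd He <- H eps Heps.
destruct (H eps Heps) as [d1 [Hd1 H1]].
exists (Rmin d d1); split; [apply Rmin_pos; assumption |].
intros y Hy.
rewrite <- (He y), <- (He z).
- apply H1; eapply Rlt_le_trans; [exact Hy | apply Rmin_r].
- replace (z - z)%C with (RtoC 0) by ring; rewrite Cmod_0; exact Hd.
- eapply Rlt_le_trans; [exact Hy | apply Rmin_l].
Qed.

Lemma cderiv_eq (f : C -> C) (z l r : C) : l = r -> cderiv f z l -> cderiv f z r.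
Proof. intros <- H; exact H. Qed.

Lemma cderiv_const (a z : C) : cderiv (fun _ => a) z 0.
Proof. apply cderiv_is_derive, @is_derive_const. Qed.

Lemma cderiv_id (z : C) : cderiv (fun y => y) z 1.
Proof. apply cderiv_is_derive_ring, @is_derive_id. Qed.

Lemma cderiv_plus (f g : C -> C) (z a b : C) :
  cderiv f z a -> cderiv g z b -> cderiv (fun y => f y + g y)%C z (a + b)%C.
Proof.
intros H1 H2; apply cderiv_is_derive.
exact (@is_derive_plus C_AbsRing C_NormedModule f g z a b
  (proj1 (cderiv_is_derive f z a) H1) (proj1 (cderiv_is_derive g z b) H2)).
Qed.

Lemma cderiv_mult (f g : C -> C) (z a b : C) :
  cderiv f z a -> cderiv g z b ->
  cderiv (fun y => f y * g y)%C z (a * g z + f z * b)%C.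
Proof.
intros H1 H2; apply cderiv_is_derive_ring.
exact (@is_derive_mult C_AbsRing f g z a b
  (proj1 (cderiv_is_derive_ring f z a) H1)
  (proj1 (cderiv_is_derive_ring g z b) H2) Cmult_comm).
Qed.

Lemma cderiv_scal (k : C) (f : C -> C) (z a : C) :
  cderiv f z a -> cderiv (fun y => k * f y)%C z (k * a)%C.
Proof.
intros H; apply cderiv_eq with (0 * f z + k * a)%C; [ring |].
apply (cderiv_mult (fun _ => k)); [apply cderiv_const | exact H].
Qed.

Lemma cderiv_minus (f g : C -> C) (z a b : C) :
  cderiv f z a -> cderiv g z b -> cderiv (fun y => f y - g y)%C z (a - b)%C.
Proof.
intros H1 H2; apply cderiv_ext_loc with (fun y => f y + -1 * g y)%C (a + -1 * b)%C 1;
  try lra; intros; try ring.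
apply cderiv_plus; [exact H1 | apply cderiv_scal, H2].
Qed.

Lemma cderiv_comp (f g : C -> C) (z a b : C) :
  cderiv f (g z) a -> cderiv g z b -> cderiv (fun y => f (g y)) z (a * b)%C.
Proof.
intros H1 H2; apply cderiv_eq with (b * a)%C; [ring |]; apply cderiv_is_derive.
exact (@is_derive_comp C_AbsRing C_NormedModule f g z a b
  (proj1 (cderiv_is_derive f _ a) H1) (proj1 (cderiv_is_derive_ring g z b) H2)).
Qed.

Lemma cderiv_cont (f : C -> C) (z l : C) : cderiv f z l -> ccont f z.
Proof.
intros H eps He.
destruct (H 1 Rlt_0_1) as [d [Hd H1]].
assert (Hl := Cmod_ge_0 l).
assert (Hq : 0 < eps / (Cmod l + 2)) by (apply Rdiv_lt_0_compat; lra).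
exists (Rmin d (eps / (Cmod l + 2))); split; [apply Rmin_pos; assumption |].
intros y Hy.
assert (Hy1 := Rlt_le_trans _ _ _ Hy (Rmin_l _ _)).
assert (Hy2 := Rlt_le_trans _ _ _ Hy (Rmin_r _ _)).
specialize (H1 y Hy1).
replace (f y - f z)%C with ((f y - f z - (y - z) * l) + (y - z) * l)%C by ring.
eapply Rle_lt_trans; [apply Cmod_triangle |].
rewrite Cmod_mult.
apply (Rmult_lt_compat_r (Cmod l + 2)) in Hy2; [| lra].
replace (eps / (Cmod l + 2) * (Cmod l + 2)) with eps in Hy2 by (field; lra).
assert (H0 := Cmod_ge_0 (y - z)); nra.
Qed.

Lemma Cmod_minus_rev (x y : C) : Cmod (x - y) = Cmod (y - x).
Proof. rewrite <- Cmod_opp; f_equal; ring. Qed.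

Lemma Cmod_minus_ge (x y : C) : Cmod x - Cmod y <= Cmod (x - y).
Proof.
assert (H := Cmod_triangle (x - y) y).
replace (x - y + y)%C with x in H by ring; lra.
Qed.

Lemma Cmod_pos (z : C) : z <> 0%C -> 0 < Cmod z.
Proof. apply Cmod_gt_0. Qed.

Lemma Cneq0_Cmod (z : C) : 0 < Cmod z -> z <> 0%C.
Proof. apply Cmod_gt_0. Qed.

Lemma cderiv_inv (f : C -> C) (z l : C) :
  f z <> 0%C -> cderiv f z l -> cderiv (fun y => / f y)%C z (- l / (f z * f z))%C.
Proof.
intros Hz Hf.
apply cderiv_eq with ((-1 / (f z * f z)) * l)%C; [field; exact Hz |].
apply (cderiv_comp Cinv f); [| exact Hf].
generalize (f z) Hz; clear; intros z Hz eps He.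
assert (Hm := Cmod_pos _ Hz).
set (m := Cmod z) in *.
(* The remainder of the inverse at [z] is (y - z)^2 / (y z^2), and |y| > m/2 on the chosen
   neighbourhood. *)
assert (Hd : 0 < eps * (m * m * m) / 2) by (apply Rdiv_lt_0_compat; [repeat apply Rmult_lt_0_compat |]; lra).
exists (Rmin (m / 2) (eps * (m * m * m) / 2)); split; [apply Rmin_pos; lra |].
intros y Hy.
assert (Hy1 := Rlt_le_trans _ _ _ Hy (Rmin_l _ _)).
assert (Hy2 := Rlt_le_trans _ _ _ Hy (Rmin_r _ _)).
assert (Hym : m / 2 < Cmod y).
{ assert (H := Cmod_minus_ge z y); rewrite Cmod_minus_rev in H; fold m in H; lra. }
assert (Hy0 : y <> 0%C) by (apply Cneq0_Cmod; lra).
replace (/ y - / z - (y - z) * (-1 / (z * z)))%C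
  with ((y - z) * ((y - z) * / (y * (z * z))))%C by (field; split; assumption).
rewrite Cmod_mult, Rmult_comm.
apply Rmult_le_compat_r; [apply Cmod_ge_0 |].
rewrite Cmod_mult, Cmod_inv by (repeat apply Cmult_neq_0; assumption).
rewrite !Cmod_mult; fold m.
assert (Hp : 0 < Cmod y * (m * m)) by (repeat apply Rmult_lt_0_compat; lra).
apply Rmult_le_reg_r with (Cmod y * (m * m)); [exact Hp |].
rewrite Rmult_assoc, Rinv_l by lra.
assert (eps * (m / 2 * (m * m)) <= eps * (Cmod y * (m * m))) by
 (apply Rmult_le_compat_l; [lra |]; apply Rmult_le_compat_r; nra).
lra.
Qed.

Lemma cderiv_div (f g : C -> C) (z a b : C) :
  g z <> 0%C -> cderiv f z a -> cderiv g z b ->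
  cderiv (fun y => f y / g y)%C z ((a * g z - f z * b) / (g z * g z))%C.
Proof.
intros Hz Hf Hg.
apply cderiv_eq with (a * / g z + f z * (- b / (g z * g z)))%C; [field; exact Hz |].
apply (cderiv_mult f (fun y => / g y)%C); [exact Hf |].
apply cderiv_inv; assumption.
Qed.

(** Derivative of a continuous branch of an inverse: comparing the expansions of [g] at [f z] and of
    [h] at [z] determines [f] to first order because [m] is nonzero. It serves both the square root
    and the Schwarz function [w] with [phi_Ne (w z) = p z]. *)
Lemma cderiv_lift (f g h : C -> C) (z m d : C) (r : R) :
  0 < r -> (forall y, Cmod (y - z) < r -> g (f y) = h y) ->
  ccont f z -> cderiv g (f z) m -> m <> 0%C -> cderiv h z d ->
  cderiv f z (d / m)%C.
Proof.
intros Hr Heq Hc Hg Hm Hh eps He.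
assert (Hm' := Cmod_pos _ Hm).
assert (Hd0 := Cmod_ge_0 d).
set (M := Cmod m) in *.
set (K := 2 * (Cmod d + 1) / M).
assert (HK : 0 < K) by (apply Rdiv_lt_0_compat; lra).
set (e1 := Rmin (M / 2) (eps * M / (2 * K))).
assert (He1 : 0 < e1).
{ apply Rmin_pos; [lra |]; apply Rdiv_lt_0_compat; nra. }
destruct (Hg e1 He1) as [d1 [Hd1 H1]].
destruct (Hc d1 Hd1) as [d2 [Hd2 H2]].
set (e2 := Rmin 1 (eps * M / 2)).
assert (He2 : 0 < e2) by (apply Rmin_pos; [lra |]; apply Rdiv_lt_0_compat; nra).
destruct (Hh e2 He2) as [d3 [Hd3 H3]].
exists (Rmin r (Rmin d2 d3)); split; [repeat apply Rmin_pos; assumption |].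
intros y Hy.
assert (Hy1 := Rlt_le_trans _ _ _ Hy (Rmin_l _ _)).
assert (Hy2 := Rlt_le_trans _ _ _ Hy (Rmin_r _ _)).
assert (Hy3 := Rlt_le_trans _ _ _ Hy2 (Rmin_r _ _)).
apply Rlt_le_trans with (2 := Rmin_l _ _) in Hy2.
specialize (H1 _ (H2 y Hy2)); specialize (H3 y Hy3).
rewrite (Heq y Hy1), (Heq z) in H1.
2:{ replace (z - z)%C with (RtoC 0) by ring; rewrite Cmod_0; exact Hr. }
assert (HT := Cmod_ge_0 (f y - f z)); assert (Ht := Cmod_ge_0 (y - z)).
set (T := Cmod (f y - f z)) in *; set (t := Cmod (y - z)) in *.
assert (E1a : e1 <= M / 2) by apply Rmin_l.
assert (E1b : e1 * (2 * K) <= eps * M).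
{ assert (E := Rmin_r (M / 2) (eps * M / (2 * K))); fold e1 in E.
  apply (Rmult_le_compat_r (2 * K)) in E; [| lra].
  replace (eps * M / (2 * K) * (2 * K)) with (eps * M) in E by (field; lra); exact E. }
assert (E2a : e2 <= 1) by apply Rmin_l.
assert (E2b : e2 <= eps * M / 2) by apply Rmin_r.
assert (HTM : T * M <= e1 * T + e2 * t + t * Cmod d).
{ unfold T, M, t; rewrite <- !Cmod_mult.
  replace ((f y - f z) * m)%C with
    (- (h y - h z - (f y - f z) * m) + (h y - h z - (y - z) * d) + (y - z) * d)%C by ring.
  eapply Rle_trans; [apply Cmod_triangle |].
  apply Rplus_le_compat_r.
  eapply Rle_trans; [apply Cmod_triangle |].
  rewrite Cmod_opp; apply Rplus_le_compat; assumption. }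
(* A Lipschitz bound for [f] at [z]: since [e1 <= M / 2], half of [T * M] absorbs the error
   [e1 * T]. It turns that error into a multiple of [t] below. *)
assert (HTK : T <= K * t).
{ apply Rmult_le_reg_r with (M / 2); [lra |].
  replace (K * t * (M / 2)) with ((Cmod d + 1) * t) by (unfold K; field; lra).
  nra. }
apply Rmult_le_reg_r with M; [assumption |].
unfold M at 1; rewrite <- Cmod_mult.
replace ((f y - f z - (y - z) * (d / m)) * m)%C with
  (- (h y - h z - (f y - f z) * m) + (h y - h z - (y - z) * d))%C by (field; exact Hm).
eapply Rle_trans; [apply Cmod_triangle |].
rewrite Cmod_opp.
apply Rle_trans with (e1 * T + e2 * t); [apply Rplus_le_compat; assumption |].
assert (e1 * T <= e1 * (K * t)) by (apply Rmult_le_compat_l; lra).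
nra.
Qed.

Lemma analytic_cderiv (f : C -> C) :
  analytic_on_disk f -> forall z, Cmod z < 1 -> cderiv f z (C_derive f z).
Proof.
intros H z Hz; apply cderiv_is_derive, C_derive_correct; [exact z | apply H, Hz].
Qed.

Lemma cderiv_analytic (f : C -> C) :
  (forall z, Cmod z < 1 -> exists l, cderiv f z l) -> analytic_on_disk f.
Proof.
intros H z Hz; destruct (H z Hz) as [l Hl]; exists l; apply cderiv_is_derive, Hl.
Qed.

Lemma cderiv_unique (f : C -> C) (z l : C) : cderiv f z l -> C_derive f z = l.
Proof. intros H; apply is_C_derive_unique, cderiv_is_derive, H. Qed.

(** The Cauchy-Riemann equations. Remainders on the real side are measured in the maximum norm,
    whence the factor [sqrt 2]. *)
Lemma cderiv_differentiable (f : C -> C) (x y : R) (l : C) :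
  cderiv f (x, y) l ->
  differentiable_pt_lim (fun u v => Re (f (u, v))) x y (Re l) (- Im l) /\
  differentiable_pt_lim (fun u v => Im (f (u, v))) x y (Im l) (Re l).
Proof.
intros H.
assert (HH : forall eps : posreal, locally_2d (fun u v =>
  Cmod (f (u, v) - f (x, y) - ((u, v) - (x, y)) * l)
  <= eps * Rmax (Rabs (u - x)) (Rabs (v - y))) x y).
{ intros eps.
  assert (H2 : 0 < sqrt 2) by (apply sqrt_lt_R0; lra).
  destruct (H (eps / sqrt 2)) as [d [Hd Hy]];
    [apply Rdiv_lt_0_compat; [apply cond_pos | exact H2] |].
  assert (Hd2 : 0 < d / sqrt 2) by (apply Rdiv_lt_0_compat; assumption).
  exists (mkposreal _ Hd2); simpl; intros u v Hu Hv.
  assert (Hm := Cmod_2Rmax ((u, v) - (x, y))).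
  simpl in Hm; fold (Rminus u x) (Rminus v y) in Hm.
  assert (Hlt : sqrt 2 * Rmax (Rabs (u - x)) (Rabs (v - y)) < d).
  { replace d with (sqrt 2 * (d / sqrt 2)) by (field; lra).
    apply Rmult_lt_compat_l; [exact H2 |]; apply Rmax_lub_lt; assumption. }
  eapply Rle_trans; [apply Hy; lra |].
  replace (eps * Rmax (Rabs (u - x)) (Rabs (v - y))) with
    (eps / sqrt 2 * (sqrt 2 * Rmax (Rabs (u - x)) (Rabs (v - y)))) by (field; lra).
  apply Rmult_le_compat_l; [| exact Hm].
  apply Rlt_le, Rdiv_lt_0_compat; [apply cond_pos | exact H2]. }
split; intros eps; (eapply locally_2d_impl; [| apply (HH eps)]);
  apply locally_2d_forall; intros u v Huv; (eapply Rle_trans; [| exact Huv]).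
- eapply Rle_trans; [| apply re_le_Cmod].
  right; f_equal; destruct l as [l1 l2]; simpl; unfold Cminus, Cplus, Copp, Cmult, Re, Im; simpl; ring.
- eapply Rle_trans; [| eapply Rle_trans; [| apply Rmax_Cmod]; apply Rmax_r].
  right; f_equal; destruct l as [l1 l2]; simpl; unfold Cminus, Cplus, Copp, Cmult, Re, Im; simpl; ring.
Qed.

(** * Goursat's theorem and maxima on rectangles *)

Lemma continuity_2d_slices (P : R -> R -> R) (x y : R) :
  continuity_2d_pt P x y ->
  continuous (fun t => P t y) x /\ continuous (fun t => P x t) y.
Proof.
intros H; split; apply continuity_pt_filterlim; intros eps He;
  destruct (H (mkposreal eps He)) as [d Hd]; exists d;
  (split; [apply cond_pos |]); intros t [_ Ht]; apply Hd;
  try exact Ht; unfold Rminus; rewrite Rplus_opp_r, Rabs_R0; apply cond_pos.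
Qed.

(* [P dx + Q dy] over the boundary of [a,b] x [c,d], counterclockwise. *)
Definition boundary_int (P Q : R -> R -> R) (a b c d : R) : R :=
  RInt (fun x => P x c - P x d) a b + RInt (fun y => Q b y - Q a y) c d.

Lemma ex_RInt_hor (P : R -> R -> R) (a b c d : R) : a <= b ->
  (forall x, a <= x <= b -> continuity_2d_pt P x c) ->
  (forall x, a <= x <= b -> continuity_2d_pt P x d) ->
  ex_RInt (fun x => P x c - P x d) a b.
Proof.
intros Hab Hc Hd; apply (@ex_RInt_continuous R_CompleteNormedModule).
rewrite Rmin_left, Rmax_right by assumption; intros z Hz.
apply (continuous_minus (fun x => P x c) (fun x => P x d));
  [apply (continuity_2d_slices P z c (Hc z Hz)) | apply (continuity_2d_slices P z d (Hd z Hz))].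
Qed.

Lemma ex_RInt_ver (Q : R -> R -> R) (a b c d : R) : c <= d ->
  (forall y, c <= y <= d -> continuity_2d_pt Q a y) ->
  (forall y, c <= y <= d -> continuity_2d_pt Q b y) ->
  ex_RInt (fun y => Q b y - Q a y) c d.
Proof.
intros Hcd Ha Hb; apply (@ex_RInt_continuous R_CompleteNormedModule).
rewrite Rmin_left, Rmax_right by assumption; intros z Hz.
apply (continuous_minus (fun y => Q b y) (fun y => Q a y));
  [apply (continuity_2d_slices Q b z (Hb z Hz)) | apply (continuity_2d_slices Q a z (Ha z Hz))].
Qed.

Definition in_rect (a b c d x y : R) : Prop := a <= x <= b /\ c <= y <= d.

Lemma boundary_int_split_x (P Q : R -> R -> R) (a e b c d : R) :
  a <= e <= b -> c <= d ->
  (forall x y, in_rect a b c d x y -> continuity_2d_pt P x y) ->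
  (forall x y, in_rect a b c d x y -> continuity_2d_pt Q x y) ->
  boundary_int P Q a b c d = boundary_int P Q a e c d + boundary_int P Q e b c d.
Proof.
intros He Hcd HP HQ; unfold boundary_int.
assert (H1 := RInt_Chasles (fun x => P x c - P x d) a e b).
rewrite <- H1; clear H1.
2,3: apply ex_RInt_hor; [lra | |]; intros x Hx; apply HP; unfold in_rect; lra.
assert (H2 : RInt (fun y => Q b y - Q a y) c d =
  plus (RInt (fun y => Q e y - Q a y) c d) (RInt (fun y => Q b y - Q e y) c d)).
{ rewrite <- RInt_plus; [apply RInt_ext; intros; unfold plus; simpl; ring | |];
  apply ex_RInt_ver; [lra | | | lra | |]; intros y Hy; apply HQ; unfold in_rect; lra. }
rewrite H2; unfold plus; simpl; ring.
Qed.

Lemma boundary_int_split_y (P Q : R -> R -> R) (a b c e d : R) :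
  a <= b -> c <= e <= d ->
  (forall x y, in_rect a b c d x y -> continuity_2d_pt P x y) ->
  (forall x y, in_rect a b c d x y -> continuity_2d_pt Q x y) ->
  boundary_int P Q a b c d = boundary_int P Q a b c e + boundary_int P Q a b e d.
Proof.
intros Hab He HP HQ; unfold boundary_int.
assert (H1 := RInt_Chasles (fun y => Q b y - Q a y) c e d).
rewrite <- H1; clear H1.
2,3: apply ex_RInt_ver; [lra | |]; intros y Hy; apply HQ; unfold in_rect; lra.
assert (H2 : RInt (fun x => P x c - P x d) a b =
  plus (RInt (fun x => P x c - P x e) a b) (RInt (fun x => P x e - P x d) a b)).
{ rewrite <- RInt_plus; [apply RInt_ext; intros; unfold plus; simpl; ring | |];
  apply ex_RInt_hor; [lra | | | lra | |]; intros x Hx; apply HP; unfold in_rect; lra. }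
rewrite H2; unfold plus; simpl; ring.
Qed.

(** The shared [m] says that the y-derivative of [P] equals the x-derivative of [Q]. The partial
    derivatives are not assumed continuous, so the vanishing of boundary integrals is proved by
    Goursat's bisection and not by Green's formula. *)
Definition closed_form_at (P Q : R -> R -> R) (x y : R) : Prop :=
  exists l m n, differentiable_pt_lim P x y l m /\ differentiable_pt_lim Q x y m n.

(** The affine part of a closed form contributes m (c - d)(b - a) from the horizontal sides and the
    opposite from the vertical ones. Only the remainders survive, at most eps/4 times [L] on each of
    the four sides. *)
Lemma boundary_int_small (P Q : R -> R -> R) (x0 y0 eps : R) :
  0 < eps -> closed_form_at P Q x0 y0 ->
  exists del, 0 < del /\ forall a b c d L,
    in_rect a b c d x0 y0 -> b - a <= L -> d - c <= L -> L < del ->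
    (forall x y, in_rect a b c d x y -> continuity_2d_pt P x y) ->
    (forall x y, in_rect a b c d x y -> continuity_2d_pt Q x y) ->
    Rabs (boundary_int P Q a b c d) <= eps * (L * L).
Proof.
intros He [l [m [n [HP HQ]]]].
assert (He4 : 0 < eps / 4) by lra.
destruct (HP (mkposreal _ He4)) as [d1 H1]; destruct (HQ (mkposreal _ He4)) as [d2 H2].
simpl in H1, H2.
exists (Rmin d1 d2); split; [apply Rmin_pos; apply cond_pos |].
intros a b c d L Hin Hab Hcd HL HcP HcQ.
assert (HL1 := Rlt_le_trans _ _ _ HL (Rmin_l _ _)).
assert (HL2 := Rlt_le_trans _ _ _ HL (Rmin_r _ _)).
assert (Hin0 := Hin).
destruct Hin as [Hx0 Hy0].
assert (Hab0 : a <= b) by lra; assert (Hcd0 : c <= d) by lra.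
assert (E : forall x y, in_rect a b c d x y -> Rabs (x - x0) <= L /\ Rabs (y - y0) <= L).
{ intros x y [Hx Hy]; split; apply Rabs_le; lra. }
assert (E1 : forall x y, in_rect a b c d x y ->
  Rabs (P x y - P x0 y0 - (l * (x - x0) + m * (y - y0))) <= eps / 4 * L).
{ intros x y Hxy; destruct (E x y Hxy).
  eapply Rle_trans; [apply H1; lra |].
  apply Rmult_le_compat_l; [lra |]; apply Rmax_lub; assumption. }
assert (E2 : forall x y, in_rect a b c d x y ->
  Rabs (Q x y - Q x0 y0 - (m * (x - x0) + n * (y - y0))) <= eps / 4 * L).
{ intros x y Hxy; destruct (E x y Hxy).
  eapply Rle_trans; [apply H2; lra |].
  apply Rmult_le_compat_l; [lra |]; apply Rmax_lub; assumption. }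
assert (X1 : ex_RInt (fun x => P x c - P x d) a b).
{ apply ex_RInt_hor; [lra | |]; intros x Hx; apply HcP; unfold in_rect; lra. }
assert (X2 : ex_RInt (fun y => Q b y - Q a y) c d).
{ apply ex_RInt_ver; [lra | |]; intros y Hy; apply HcQ; unfold in_rect; lra. }
assert (Y1 : Rabs (RInt (fun x => minus (P x c - P x d) (m * (c - d))) a b)
  <= (b - a) * (eps / 2 * L)).
{ apply abs_RInt_le_const; [lra | apply @ex_RInt_minus; [exact X1 | apply ex_RInt_const] |].
  intros x Hx; unfold minus, plus, opp; simpl.
  assert (A1 := E1 x c (conj Hx (conj (Rle_refl c) Hcd0))).
  assert (A2 := E1 x d (conj Hx (conj Hcd0 (Rle_refl d)))).
  apply Rabs_le; apply Rabs_le_between in A1; apply Rabs_le_between in A2; lra. }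
assert (Y2 : Rabs (RInt (fun y => minus (Q b y - Q a y) (m * (b - a))) c d)
  <= (d - c) * (eps / 2 * L)).
{ apply abs_RInt_le_const; [lra | apply @ex_RInt_minus; [exact X2 | apply ex_RInt_const] |].
  intros y Hy; unfold minus, plus, opp; simpl.
  assert (A1 := E2 a y (conj (conj (Rle_refl a) Hab0) Hy)).
  assert (A2 := E2 b y (conj (conj Hab0 (Rle_refl b)) Hy)).
  apply Rabs_le; apply Rabs_le_between in A1; apply Rabs_le_between in A2; lra. }
assert (Z1 : RInt (fun x => minus (P x c - P x d) (m * (c - d))) a b =
  RInt (fun x => P x c - P x d) a b - (b - a) * (m * (c - d))).
{ etransitivity; [apply @RInt_minus; [exact X1 | apply ex_RInt_const] |].
  rewrite RInt_const; reflexivity. }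
assert (Z2 : RInt (fun y => minus (Q b y - Q a y) (m * (b - a))) c d =
  RInt (fun y => Q b y - Q a y) c d - (d - c) * (m * (b - a))).
{ etransitivity; [apply @RInt_minus; [exact X2 | apply ex_RInt_const] |].
  rewrite RInt_const; reflexivity. }
rewrite Z1 in Y1; rewrite Z2 in Y2; unfold boundary_int.
assert (HL0 : 0 <= L) by lra.
assert (B1 : (b - a) * (eps / 2 * L) <= L * (eps / 2 * L)) by (apply Rmult_le_compat_r; nra).
assert (B2 : (d - c) * (eps / 2 * L) <= L * (eps / 2 * L)) by (apply Rmult_le_compat_r; nra).
apply Rabs_le; apply Rabs_le_between in Y1; apply Rabs_le_between in Y2; lra.
Qed.

(** * Bisection of rectangles *)

Lemma nested_limit (u : nat -> R) (h : R) :
  0 <= h ->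
  (forall n, u n <= u (S n) <= u n + h / 2 ^ S n) ->
  exists l, forall n, u n <= l <= u n + h / 2 ^ n.
Proof.
intros Hh Hu.
assert (Hp : forall n, 0 < 2 ^ n) by (intros; apply pow_lt; lra).
assert (Hd : forall n m, u n <= u (n + m)%nat <= u n + h / 2 ^ n - h / 2 ^ (n + m)).
{ intros n; induction m as [| m IH].
  - rewrite Nat.add_0_r; lra.
  - rewrite Nat.add_succ_r; specialize (Hu (n + m)%nat).
    replace (h / 2 ^ (n + m)) with (2 * (h / 2 ^ S (n + m))) in IH; [lra |].
    simpl; field; apply Rgt_not_eq, Hp. }
assert (Hb : forall n, 0 <= h / 2 ^ n).
{ intros n; apply Rmult_le_pos; [exact Hh | apply Rlt_le, Rinv_0_lt_compat, Hp]. }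
destruct (ex_finite_lim_seq_incr u (u O + h)) as [l Hl].
- intros n; apply Hu.
- intros n; specialize (Hd O n); specialize (Hb n); simpl in Hd; lra.
- exists l; intros n; split.
  + apply (is_lim_seq_incr_compare u l Hl); intros; apply Hu.
  + apply (is_lim_seq_le (fun m => u (n + m)%nat) (fun _ => u n + h / 2 ^ n) l (u n + h / 2 ^ n)).
    * intros m; specialize (Hd n m); specialize (Hb (n + m)%nat); lra.
    * apply (is_lim_seq_ext (fun m => u (m + n)%nat)); [intros; f_equal; lia |].
      apply is_lim_seq_incr_n, Hl.
    * apply is_lim_seq_const.
Qed.

(** Selection by informative excluded middle. The last quarter is the default: it is bad as soon as
    some quarter is bad and the other three are not. *)
Definition quarter_step (Bad : R -> R -> R -> R -> Prop) (h k : R) (p : R * R) : R * R :=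
  let (a, c) := p in
  if excluded_middle_informative (Bad a (a + h) c (c + k)) then (a, c)
  else if excluded_middle_informative (Bad (a + h) (a + h + h) c (c + k))
  then (a + h, c)
  else if excluded_middle_informative (Bad a (a + h) (c + k) (c + k + k))
  then (a, c + k)
  else (a + h, c + k).

Fixpoint quarter_seq (Bad : R -> R -> R -> R -> Prop) (a c h k : R) (n : nat) : R * R :=
  match n with
  | O => (a, c)
  | S n => quarter_step Bad (h / 2 ^ S n) (k / 2 ^ S n) (quarter_seq Bad a c h k n)
  end.

(** A property that always passes to one of the four quarters concentrates at a point. It is kept
    abstract because it is used twice: for Goursat's theorem and for the existence of maxima. *)
Lemma bisection_2d (Bad : R -> R -> R -> R -> Prop) (a b c d : R) :
  a <= b -> c <= d -> Bad a b c d ->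
  (forall p q h k, 0 <= h -> 0 <= k -> a <= p -> p + h + h <= b -> c <= q -> q + k + k <= d ->
    Bad p (p + h + h) q (q + k + k) ->
    Bad p (p + h) q (q + k) \/ Bad (p + h) (p + h + h) q (q + k) \/
    Bad p (p + h) (q + k) (q + k + k) \/ Bad (p + h) (p + h + h) (q + k) (q + k + k)) ->
  exists x0 y0, in_rect a b c d x0 y0 /\ forall del, 0 < del ->
    exists a' b' c' d', in_rect a' b' c' d' x0 y0 /\ a <= a' /\ b' <= b /\ c <= c' /\ d' <= d /\
  (b' - a') + (d' - c') < del /\ Bad a' b' c' d'.
Proof.
intros Hab Hcd HBad Hquarter.
set (h := b - a); set (k := d - c).
set (s := quarter_seq Bad a c h k).
assert (Hp : forall n, 0 < 2 ^ n) by (intros; apply pow_lt; lra).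
assert (Hhn : forall n, 0 <= h / 2 ^ n).
{ intros n; apply Rmult_le_pos; [unfold h; lra | apply Rlt_le, Rinv_0_lt_compat, Hp]. }
assert (Hkn : forall n, 0 <= k / 2 ^ n).
{ intros n; apply Rmult_le_pos; [unfold k; lra | apply Rlt_le, Rinv_0_lt_compat, Hp]. }
assert (Hh2 : forall n, h / 2 ^ n = h / 2 ^ S n + h / 2 ^ S n).
{ intros n; simpl; field; apply Rgt_not_eq, Hp. }
assert (Hk2 : forall n, k / 2 ^ n = k / 2 ^ S n + k / 2 ^ S n).
{ intros n; simpl; field; apply Rgt_not_eq, Hp. }
assert (Hstep : forall n p q, s n = (p, q) ->
  a <= p -> p + h / 2 ^ n <= b -> c <= q -> q + k / 2 ^ n <= d ->
  Bad p (p + h / 2 ^ n) q (q + k / 2 ^ n) ->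
  exists p' q', s (S n) = (p', q') /\ p <= p' <= p + h / 2 ^ S n /\
    q <= q' <= q + k / 2 ^ S n /\ Bad p' (p' + h / 2 ^ S n) q' (q' + k / 2 ^ S n)).
{ intros n p q Hs H1 H2 H3 H4 H5.
  change (s (S n)) with (quarter_step Bad (h / 2 ^ S n) (k / 2 ^ S n) (s n)).
  rewrite Hs; rewrite Hh2 in H2, H5; rewrite Hk2 in H4, H5.
  generalize (Hhn (S n)) (Hkn (S n)).
  set (h' := h / 2 ^ S n) in *; set (k' := k / 2 ^ S n) in *; intros Hh' Hk'.
  rewrite <- (Rplus_assoc p) in H2, H5; rewrite <- (Rplus_assoc q) in H4, H5.
  specialize (Hquarter p q h' k' Hh' Hk' H1 H2 H3 H4 H5).
  unfold quarter_step; repeat destruct excluded_middle_informative;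
    do 2 eexists; (split; [reflexivity |]); repeat split; try lra; tauto. }
assert (Hinv : forall n, exists p q, s n = (p, q) /\
  a <= p /\ p + h / 2 ^ n <= b /\ c <= q /\ q + k / 2 ^ n <= d /\
  Bad p (p + h / 2 ^ n) q (q + k / 2 ^ n)).
{ induction n as [| n [p [q [Hs [H1 [H2 [H3 [H4 H5]]]]]]]].
  - exists a, c; simpl; unfold Rdiv; rewrite Rinv_1, !Rmult_1_r.
    replace (a + h) with b by (unfold h; ring); replace (c + k) with d by (unfold k; ring).
    repeat split; try lra; exact HBad.
  - destruct (Hstep n p q Hs H1 H2 H3 H4 H5) as [p' [q' [Hs' [Hp' [Hq' H']]]]].
    exists p', q'; rewrite Hh2 in H2; rewrite Hk2 in H4.
    repeat split; try assumption; lra. }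
assert (Hmon : forall n, fst (s n) <= fst (s (S n)) <= fst (s n) + h / 2 ^ S n /\
                         snd (s n) <= snd (s (S n)) <= snd (s n) + k / 2 ^ S n).
{ intros n; destruct (Hinv n) as [p [q [Hs [H1 [H2 [H3 [H4 H5]]]]]]].
  destruct (Hstep n p q Hs H1 H2 H3 H4 H5) as [p' [q' [Hs' [Hp' [Hq' H']]]]].
  rewrite Hs, Hs'; simpl fst; simpl snd; split; assumption. }
destruct (nested_limit (fun n => fst (s n)) h) as [x0 Hx0];
  [unfold h; lra | intros n; apply Hmon |].
destruct (nested_limit (fun n => snd (s n)) k) as [y0 Hy0];
  [unfold k; lra | intros n; apply Hmon |].
exists x0, y0; split.
{ specialize (Hx0 O); specialize (Hy0 O); simpl in Hx0, Hy0.
  unfold in_rect; unfold h in Hx0; unfold k in Hy0; lra. }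
intros del Hdel.
set (L := h + k + 1).
assert (HL : 0 < L) by (unfold L, h, k; lra).
destruct (pow_lt_1_zero (/ 2) (ltac:(rewrite Rabs_pos_eq; lra)) (del / L)) as [N HN];
  [apply Rdiv_lt_0_compat; assumption |].
specialize (HN N (Nat.le_refl N)).
rewrite Rabs_pos_eq, pow_inv in HN by (apply pow_le; lra).
destruct (Hinv N) as [p [q [Hs [H1 [H2 [H3 [H4 H5]]]]]]].
specialize (Hx0 N); specialize (Hy0 N); rewrite Hs in Hx0, Hy0; simpl in Hx0, Hy0.
exists p, (p + h / 2 ^ N), q, (q + k / 2 ^ N).
repeat split; try assumption; try lra.
assert (Hinv2 : 0 < / 2 ^ N) by apply Rinv_0_lt_compat, Hp.
apply (Rmult_lt_compat_l L) in HN; [| exact HL].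
replace (L * (del / L)) with del in HN by (field; lra).
unfold Rdiv; unfold L in HN; lra.
Qed.

Lemma closed_form_continuity (P Q : R -> R -> R) (x y : R) :
  closed_form_at P Q x y -> continuity_2d_pt P x y /\ continuity_2d_pt Q x y.
Proof.
intros [l [m [n [H1 H2]]]]; split; apply differentiable_continuity_pt;
  [exists l, m | exists m, n]; assumption.
Qed.

Lemma closed_form_boundary_int (P Q : R -> R -> R) (a b c d : R) :
  a <= b -> c <= d ->
  (forall x y, in_rect a b c d x y -> closed_form_at P Q x y) ->
  boundary_int P Q a b c d = 0.
Proof.
intros Hab Hcd Hcl.
destruct (Req_dec (boundary_int P Q a b c d) 0) as [H0 | H0]; [exact H0 | exfalso].
assert (HP := fun x y H => proj1 (closed_form_continuity P Q x y (Hcl x y H))).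
assert (HQ := fun x y H => proj2 (closed_form_continuity P Q x y (Hcl x y H))).
apply Rabs_pos_lt in H0.
(* The [+ 1] makes the starting inequality of the bisection strict and keeps [L] positive on
   degenerate rectangles. *)
set (L := (b - a) + (d - c) + 1).
assert (HL : 0 < L) by (unfold L; lra).
assert (HLL : 0 < L * L) by (apply Rmult_lt_0_compat; lra).
set (eta := Rabs (boundary_int P Q a b c d) / (L * L)).
assert (Heta : 0 < eta) by (apply Rdiv_lt_0_compat; assumption).
(* Bad means that the integral exceeds [eta] times the squared half-perimeter. That square drops to
   a quarter in each quarter, so the triangle inequality leaves at least one of them bad, while
   [boundary_int_small] forbids arbitrarily small bad rectangles. *)
destruct (bisection_2d (fun a b c d =>
  eta * Rsqr ((b - a) + (d - c)) < Rabs (boundary_int P Q a b c d)) a b c d)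
  as [x0 [y0 [Hin Hbad]]]; try assumption.
- replace (Rabs (boundary_int P Q a b c d)) with (eta * (L * L)) by (unfold eta; field; lra).
  apply Rmult_lt_compat_l; [exact Heta |]; apply Rsqr_incrst_1; unfold L; lra.
- intros p q h k Hh Hk Hp Hph Hq Hqk Hb.
  assert (HP' : forall x y, in_rect p (p + h + h) q (q + k + k) x y -> continuity_2d_pt P x y)
    by (intros x y Hxy; apply HP; unfold in_rect in *; lra).
  assert (HQ' : forall x y, in_rect p (p + h + h) q (q + k + k) x y -> continuity_2d_pt Q x y)
    by (intros x y Hxy; apply HQ; unfold in_rect in *; lra).
  rewrite (boundary_int_split_x P Q p (p + h)) in Hb by (try assumption; lra).
  rewrite (boundary_int_split_y P Q p (p + h) q (q + k) (q + k + k)) in Hb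
    by first [lra | intros x y Hxy; first [apply HP' | apply HQ']; unfold in_rect in *; lra].
  rewrite (boundary_int_split_y P Q (p + h) (p + h + h) q (q + k) (q + k + k)) in Hb
    by first [lra | intros x y Hxy; first [apply HP' | apply HQ']; unfold in_rect in *; lra].
  set (E := eta * Rsqr (h + k)).
  assert (HE : forall u v w t, v - u = h -> t - w = k -> eta * Rsqr ((v - u) + (t - w)) = E)
    by (intros u v w t -> ->; reflexivity).
  rewrite !HE by ring.
  replace (eta * _) with (4 * E) in Hb by (unfold E, Rsqr; ring).
  destruct (Rlt_dec E (Rabs (boundary_int P Q p (p + h) q (q + k)))) as [H1 | H1];
    [left; exact H1 | right].
  destruct (Rlt_dec E (Rabs (boundary_int P Q (p + h) (p + h + h) q (q + k)))) as [H2 | H2];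
    [left; exact H2 | right].
  destruct (Rlt_dec E (Rabs (boundary_int P Q p (p + h) (q + k) (q + k + k)))) as [H3 | H3];
    [left; exact H3 | right].
  assert (T1 := Rabs_triang (boundary_int P Q p (p + h) q (q + k))
    (boundary_int P Q p (p + h) (q + k) (q + k + k))).
  assert (T2 := Rabs_triang (boundary_int P Q (p + h) (p + h + h) q (q + k))
    (boundary_int P Q (p + h) (p + h + h) (q + k) (q + k + k))).
  assert (T3 := Rabs_triang (boundary_int P Q p (p + h) q (q + k) +
    boundary_int P Q p (p + h) (q + k) (q + k + k))
   (boundary_int P Q (p + h) (p + h + h) q (q + k) +
    boundary_int P Q (p + h) (p + h + h) (q + k) (q + k + k))).
  lra.
- destruct (boundary_int_small P Q x0 y0 eta Heta (Hcl _ _ Hin)) as [del [Hdel Hsm]].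
  destruct (Hbad del Hdel) as [a' [b' [c' [d' [Hin' [Ha [Hb [Hc [Hd [Hs HB]]]]]]]]]].
  assert (Hin2 := Hin'); destruct Hin2 as [Hx Hy].
  apply (Rlt_irrefl (Rabs (boundary_int P Q a' b' c' d'))).
  eapply Rle_lt_trans; [| exact HB].
  apply Hsm; try assumption; try lra;
    intros x y Hxy; [apply HP | apply HQ]; unfold in_rect in *; lra.
Qed.

(** If no maximum exists, call a subrectangle bad when every value of [f] on the whole rectangle is
    exceeded inside it. Were all four quarters good, the largest of their four bounds, itself a
    value of [f], would be exceeded nowhere. At the limit point some value is strictly larger, and
    continuity keeps [f] below that value nearby. *)
Lemma rect_max (f : R -> R -> R) (a b c d : R) :
  a <= b -> c <= d ->
  (forall x y, in_rect a b c d x y -> continuity_2d_pt f x y) ->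
  exists x y, in_rect a b c d x y /\ forall u v, in_rect a b c d u v -> f u v <= f x y.
Proof.
intros Hab Hcd Hf; apply NNPP; intros Hno.
assert (Hup : forall x y, in_rect a b c d x y ->
  exists u v, in_rect a b c d u v /\ f x y < f u v).
{ intros x y Hxy; apply NNPP; intros Hn; apply Hno; exists x, y; split; [exact Hxy |].
  intros u v Huv; apply Rnot_lt_le; intros Hlt; apply Hn; exists u, v; split; assumption. }
destruct (bisection_2d (fun p q r s => forall x y, in_rect a b c d x y ->
  exists u v, in_rect p q r s u v /\ f x y < f u v) a b c d) as [x0 [y0 [Hin Hbad]]];
  try assumption.
- intros p q h k Hh Hk _ _ _ _ HB.
  assert (Hneg : forall r s t w, ~ (forall x y, in_rect a b c d x y ->
      exists u v, in_rect r s t w u v /\ f x y < f u v) ->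
    exists x y, in_rect a b c d x y /\ forall u v, in_rect r s t w u v -> f u v <= f x y).
  { intros r s t w Hn; apply NNPP; intros Hn2; apply Hn; intros x y Hxy.
    apply NNPP; intros Hn3; apply Hn2; exists x, y; split; [exact Hxy |].
    intros u v Huv; apply Rnot_lt_le; intros Hlt; apply Hn3; exists u, v; split; assumption. }
  assert (Hmax : forall x y x' y', in_rect a b c d x y -> in_rect a b c d x' y' ->
    exists x'' y'', in_rect a b c d x'' y'' /\ f x y <= f x'' y'' /\ f x' y' <= f x'' y'').
  { intros x y x' y' H H'; destruct (Rle_dec (f x y) (f x' y'));
      [exists x', y' | exists x, y]; repeat split; try assumption; try apply H; try apply H'; lra. }
  apply NNPP; intros Hn.
  apply not_or_and in Hn; destruct Hn as [N1 Hn].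
  apply not_or_and in Hn; destruct Hn as [N2 Hn].
  apply not_or_and in Hn; destruct Hn as [N3 N4].
  destruct (Hneg _ _ _ _ N1) as [x1 [y1 [I1 M1]]]; destruct (Hneg _ _ _ _ N2) as [x2 [y2 [I2 M2]]].
  destruct (Hneg _ _ _ _ N3) as [x3 [y3 [I3 M3]]]; destruct (Hneg _ _ _ _ N4) as [x4 [y4 [I4 M4]]].
  destruct (Hmax _ _ _ _ I1 I2) as [x5 [y5 [I5 [L1 L2]]]].
  destruct (Hmax _ _ _ _ I3 I4) as [x6 [y6 [I6 [L3 L4]]]].
  destruct (Hmax _ _ _ _ I5 I6) as [x7 [y7 [I7 [L5 L6]]]].
  destruct (HB _ _ I7) as [u [v [[Hu Hv] Hlt]]].
  destruct (Rle_dec u (p + h)), (Rle_dec v (q + k)).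
  + specialize (M1 u v); unfold in_rect in M1; lra.
  + specialize (M3 u v); unfold in_rect in M3; lra.
  + specialize (M2 u v); unfold in_rect in M2; lra.
  + specialize (M4 u v); unfold in_rect in M4; lra.
- destruct (Hup x0 y0 Hin) as [x [y [Hxy Hlt]]].
  destruct (Hf x0 y0 Hin (mkposreal _ (proj2 (Rlt_0_minus _ _) Hlt))) as [del Hdel]; simpl in Hdel.
  destruct (Hbad del (cond_pos del)) as [a' [b' [c' [d' [[Hx Hy] [Ha [Hb [Hc [Hd [Hs HB]]]]]]]]]].
  destruct (HB x y Hxy) as [u [v [[Hu Hv] Huv]]].
  assert (Hc2 : Rabs (f u v - f x0 y0) < f x y - f x0 y0)
    by (apply Hdel; apply Rabs_lt_between; lra).
  apply Rabs_lt_between in Hc2; lra.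
Qed.

(** * Schwarz lemma *)

Lemma differentiable_mult (f g : R -> R -> R) (x y fx fy gx gy : R) :
  differentiable_pt_lim f x y fx fy -> differentiable_pt_lim g x y gx gy ->
  differentiable_pt_lim (fun u v => f u v * g u v) x y
    (g x y * fx + f x y * gx) (g x y * fy + f x y * gy).
Proof.
intros Hf Hg.
apply (differentiable_pt_lim_comp Rmult f g); [| assumption | assumption].
generalize (f x y) (g x y); clear; intros a b eps.
exists eps; intros u v Hu Hv.
replace (u * v - a * b - (b * (u - a) + a * (v - b))) with ((u - a) * (v - b)) by ring.
rewrite Rabs_mult; apply Rmult_le_compat; try apply Rabs_pos; [lra | apply Rmax_r].
Qed.

Lemma differentiable_fst (f : R -> R) (x y l : R) :
  is_derive f x l -> differentiable_pt_lim (fun u _ => f u) x y l 0.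
Proof. intros H; apply differentiable_pt_lim_proj1_0, is_derive_Reals, H. Qed.

Lemma differentiable_snd (f : R -> R) (x y l : R) :
  is_derive f y l -> differentiable_pt_lim (fun _ v => f v) x y 0 l.
Proof.
intros H eps.
assert (H1 := differentiable_fst f y x l H eps).
destruct H1 as [d H1]; exists d; intros u v Hu Hv.
eapply Rle_trans; [| rewrite Rmax_comm; apply (H1 v u Hv Hu)].
right; f_equal; ring.
Qed.

Lemma differentiable_translate (f : R -> R -> R) (k x y a b : R) :
  differentiable_pt_lim f x y a b -> differentiable_pt_lim (fun u v => k + f u v) x y a b.
Proof.
intros H eps; eapply locally_2d_impl; [| apply (H eps)].
apply locally_2d_forall; intros u v Huv; eapply Rle_trans; [| exact Huv].
right; f_equal; ring.
Qed.

Definition polar (z0 : C) (r t : R) : C := (fst z0 + r * cos t, snd z0 + r * sin t).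

Lemma Cmod_polar (z0 : C) (r t : R) : 0 <= r -> Cmod (polar z0 r t - z0) = r.
Proof.
intros Hr; unfold Cmod, polar, Cminus, Cplus, Copp; simpl fst; simpl snd.
replace (_ + _) with (Rsqr r * (Rsqr (sin t) + Rsqr (cos t))) by (unfold Rsqr; ring).
rewrite sin2_cos2, Rmult_1_r; apply sqrt_Rsqr, Hr.
Qed.

Lemma differentiable_polar (z0 : C) (r t : R) :
  differentiable_pt_lim (fun r t => fst z0 + r * cos t) r t (cos t) (- r * sin t) /\
  differentiable_pt_lim (fun r t => snd z0 + r * sin t) r t (sin t) (r * cos t).
Proof.
split; apply differentiable_translate.
- replace (cos t) with (cos t * 1 + r * 0) at 1 by ring.
  replace (- r * sin t) with (cos t * 0 + r * (- sin t)) by ring.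
  apply (differentiable_mult (fun r _ => r) (fun _ t => cos t)).
  + apply (differentiable_fst (fun r => r)), @is_derive_id.
  + apply (differentiable_snd cos), is_derive_cos.
- replace (sin t) with (sin t * 1 + r * 0) at 1 by ring.
  replace (r * cos t) with (sin t * 0 + r * cos t) by ring.
  apply (differentiable_mult (fun r _ => r) (fun _ t => sin t)).
  + apply (differentiable_fst (fun r => r)), @is_derive_id.
  + apply (differentiable_snd sin), is_derive_sin.
Qed.

(** With z = z0 + r e^(it), the form f(z) dz / (z - z0) equals f (dr/r + i dt); [P dr + Q dt] is its
    imaginary part, so the boundary integral compares means of Re f over circles. *)
Lemma closed_form_polar (f : C -> C) (z0 l : C) (r t : R) :
  0 < r -> cderiv f (polar z0 r t) l ->
  closed_form_at (fun r t => / r * Im (f (polar z0 r t))) (fun r t => Re (f (polar z0 r t))) r t.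
Proof.
intros Hr Hl.
destruct (cderiv_differentiable f _ _ l Hl) as [HR HI].
destruct (differentiable_polar z0 r t) as [Hu Hv].
assert (HQ := differentiable_pt_lim_comp _ _ _ r t _ _ _ _ _ _ HR Hu Hv).
assert (HP := differentiable_pt_lim_comp _ _ _ r t _ _ _ _ _ _ HI Hu Hv).
assert (Hi : differentiable_pt_lim (fun r _ => / r) r t (- 1 / r ^ 2) 0).
{ apply (differentiable_fst Rinv); auto_derive; [lra | field; lra]. }
assert (HP2 := differentiable_mult _ _ r t _ _ _ _ Hi HP).
simpl in HP2.
eexists _, _, _; split; [exact HP2 |].
replace (_ + / r * _) with (Re l * cos t + - Im l * sin t) by (field; lra).
exact HQ.
Qed.

(** Goursat on [r, rho] x [0, 2 pi]: the sides t = 0 and t = 2 pi cancel by periodicity, so the mean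
    of Re f is the same on both circles, and the inner one shrinks to the centre by continuity. At
    the centre only continuity is asked, since the function is going to be w(z)/z with its removable
    singularity. *)
Lemma mean_value_le (f : C -> C) (z0 : C) (rho M : R) :
  0 < rho ->
  (forall z : C, 0 < Cmod (z - z0) <= rho -> exists l, cderiv f z l) ->
  ccont f z0 ->
  (forall z, Cmod (z - z0) = rho -> Re (f z) <= M) ->
  Re (f z0) <= M.
Proof.
intros Hrho Hd Hc HM.
assert (HPI := PI_RGT_0).
apply Rnot_lt_le; intros Hlt.
destruct (Hc ((Re (f z0) - M) / 2)) as [d [Hd0 Hcd]]; [lra |].
set (r := Rmin rho d / 2).
assert (Hm := Rmin_pos _ _ Hrho Hd0).
assert (Hm1 := Rmin_l rho d); assert (Hm2 := Rmin_r rho d).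
assert (Hr : 0 < r < rho /\ r < d) by (unfold r; lra).
set (P := fun r t => / r * Im (f (polar z0 r t))).
set (Q := fun r t => Re (f (polar z0 r t))).
assert (Hcl : forall x y, in_rect r rho 0 (2 * PI) x y -> closed_form_at P Q x y).
{ intros x y [Hx Hy]; destruct (Hd (polar z0 x y)) as [l Hl].
  - rewrite Cmod_polar; lra.
  - apply closed_form_polar with l; [lra | exact Hl]. }
assert (HB := closed_form_boundary_int P Q r rho 0 (2 * PI) (ltac:(lra)) (ltac:(lra)) Hcl).
unfold boundary_int in HB.
assert (Hper : RInt (fun x => P x 0 - P x (2 * PI)) r rho = 0).
{ rewrite (RInt_ext _ (fun _ => 0)).
  - rewrite RInt_const; apply Rmult_0_r.
  - intros x _; unfold P, polar; rewrite cos_2PI, sin_2PI, cos_0, sin_0; apply Rminus_diag_eq; reflexivity. }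
rewrite Hper, Rplus_0_l in HB.
assert (HI : RInt (fun y => Q rho y - Q r y) 0 (2 * PI) <=
             RInt (fun _ => - ((Re (f z0) - M) / 2)) 0 (2 * PI)).
{ apply RInt_le; [lra | | apply ex_RInt_const |].
  - apply ex_RInt_ver; [lra | |]; intros y Hy;
      apply (closed_form_continuity P), Hcl; unfold in_rect; lra.
  - intros t Ht; unfold Q.
    assert (A1 := HM (polar z0 rho t) (Cmod_polar z0 rho t (ltac:(lra)))).
    assert (A2 := Hcd (polar z0 r t)).
    rewrite Cmod_polar in A2 by lra.
    specialize (A2 (proj2 Hr)).
    assert (A3 := re_le_Cmod (f (polar z0 r t) - f z0)).
    apply Rabs_le_between in A3; unfold Cminus in A2, A3; rewrite re_plus, re_opp in A3; lra. }
rewrite RInt_const in HI.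
change (RInt (fun y => Q rho y - Q r y) 0 (2 * PI) <= (2 * PI - 0) * (- ((Re (f z0) - M) / 2))) in HI.
rewrite HB in HI; clear HB Hper.
assert (H0 : 0 < PI * (Re (f z0) - M)) by (apply Rmult_lt_0_compat; lra).
lra.
Qed.

Lemma Cmod_le_sum (z : C) : Cmod z <= Rabs (fst z) + Rabs (snd z).
Proof.
destruct z as [x y]; unfold Cmod; simpl fst; simpl snd.
assert (Hx := Rabs_pos x); assert (Hy := Rabs_pos y).
rewrite <- (sqrt_Rsqr (Rabs x + Rabs y)) by lra.
apply sqrt_le_1_alt; unfold Rsqr.
rewrite <- (pow2_abs x), <- (pow2_abs y); nra.
Qed.

Lemma Cmod_polar_continuity (g : C -> C) (z0 : C) (r t : R) :
  ccont g (polar z0 r t) ->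
  continuity_2d_pt (fun r t => Cmod (g (polar z0 r t))) r t.
Proof.
intros Hg eps.
destruct (Hg eps (cond_pos eps)) as [d [Hd Hy]].
assert (Hd2 : 0 < d / 2) by lra.
destruct (differentiable_polar z0 r t) as [Hu Hv].
destruct (differentiable_continuity_pt _ _ _ (ex_intro _ _ (ex_intro _ _ Hu)) (mkposreal _ Hd2)) as [d1 H1].
destruct (differentiable_continuity_pt _ _ _ (ex_intro _ _ (ex_intro _ _ Hv)) (mkposreal _ Hd2)) as [d2 H2].
simpl in H1, H2.
assert (Hm : 0 < Rmin d1 d2) by (apply Rmin_pos; apply cond_pos).
exists (mkposreal _ Hm); simpl; intros u v Hu' Hv'.
assert (Hlt : Cmod (polar z0 u v - polar z0 r t) < d).
{ eapply Rle_lt_trans; [apply Cmod_le_sum |].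
  specialize (H1 u v (Rlt_le_trans _ _ _ Hu' (Rmin_l _ _)) (Rlt_le_trans _ _ _ Hv' (Rmin_l _ _))).
  specialize (H2 u v (Rlt_le_trans _ _ _ Hu' (Rmin_r _ _)) (Rlt_le_trans _ _ _ Hv' (Rmin_r _ _))).
  simpl; fold (Rminus (fst z0 + u * cos v) (fst z0 + r * cos t)).
  fold (Rminus (snd z0 + u * sin v) (snd z0 + r * sin t)).
  lra. }
specialize (Hy _ Hlt).
assert (A1 := Cmod_minus_ge (g (polar z0 u v)) (g (polar z0 r t))).
assert (A2 := Cmod_minus_ge (g (polar z0 r t)) (g (polar z0 u v))).
rewrite Cmod_minus_rev in A2.
apply Rabs_lt_between; lra.
Qed.

Lemma polar_surj (z : C) : exists t, 0 <= t <= 2 * PI /\ z = polar 0 (Cmod z) t.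
Proof.
destruct z as [x y].
assert (HPI := PI_RGT_0).
destruct (Req_dec (Cmod (x, y)) 0) as [H0 | H0].
{ exists 0; split; [lra |]; unfold polar; rewrite H0; apply Cmod_eq_0 in H0.
  rewrite H0; unfold RtoC; simpl; f_equal; ring. }
assert (Hr : 0 < Cmod (x, y)) by (assert (H := Cmod_ge_0 (x, y)); lra).
set (r := Cmod (x, y)) in *.
assert (Hrr : x * x + y * y = r * r).
{ unfold r, Cmod; simpl fst; simpl snd; rewrite sqrt_sqrt; [ring | nra]. }
assert (Hx : -1 <= x / r <= 1).
{ split; apply Rmult_le_reg_r with r; try assumption;
    replace (x / r * r) with x by (field; lra); nra. }
assert (Hs : r * sin (acos (x / r)) = Rabs y).
{ rewrite sin_acos by exact Hx.
  replace (1 - Rsqr (x / r)) with (Rsqr (y / r)).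
  2:{ apply Rmult_eq_reg_r with (r * r); [unfold Rsqr; field_simplify; [lra | lra | lra] | nra]. }
  rewrite sqrt_Rsqr_abs; unfold Rdiv.
  rewrite Rabs_mult, (Rabs_pos_eq (/ r)) by (apply Rlt_le, Rinv_0_lt_compat, Hr).
  field; lra. }
assert (Hb := acos_bound (x / r)).
destruct (Rle_dec 0 y) as [Hy | Hy].
- exists (acos (x / r)); split; [lra |].
  unfold polar; rewrite cos_acos by exact Hx; simpl fst; simpl snd; rewrite Hs, Rabs_pos_eq by exact Hy.
  f_equal; [field; lra | ring].
- exists (2 * PI - acos (x / r)); split; [lra |].
  unfold polar; rewrite cos_minus, sin_minus, cos_2PI, sin_2PI, cos_acos by exact Hx.
  simpl fst; simpl snd.
  replace (0 + r * (0 * (x / r) - 1 * sin (acos (x / r)))) with (- (r * sin (acos (x / r)))) by ring.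
  rewrite Hs, Rabs_left by lra; f_equal; [field; lra | ring].
Qed.

Lemma Cmod_sqr (z : C) : Cmod z * Cmod z = Re z * Re z + Im z * Im z.
Proof.
destruct z as [x y]; unfold Cmod; simpl; rewrite sqrt_sqrt; nra.
Qed.

Lemma unit_phase (a : C) : exists c, Cmod c <= 1 /\ (c * a)%C = RtoC (Cmod a).
Proof.
destruct (Ceq_dec a 0) as [-> | Ha].
- exists 0%C; rewrite !Cmod_0; split; [lra | ring].
- assert (Hm := Cmod_pos _ Ha).
  exists (Cconj a * RtoC (/ Cmod a))%C; split.
  + rewrite Cmod_mult, Cmod_conj, Cmod_R, Rabs_pos_eq
      by (apply Rlt_le, Rinv_0_lt_compat, Hm).
    right; field; lra.
  + assert (E := Cmod_sqr a).
    replace (Cmod a) with (Cmod a * Cmod a * / Cmod a) at 2 by (field; lra).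
    rewrite E, RtoC_mult.
    destruct a as [x y]; unfold Cconj, Cmult, RtoC; simpl.
    f_equal; ring.
Qed.

Lemma Re_le_Cmod (z : C) : Re z <= Cmod z.
Proof. assert (H := re_le_Cmod z); apply Rabs_le_between in H; lra. Qed.

(* The maximum of [|w z / z| + eps |z|^2] over a disc is not attained inside it,
   the second term being strictly subharmonic. *)
Lemma schwarz (w : C -> C) :
  (forall z : C, Cmod z < 1 -> exists l, cderiv w z l) -> w 0%C = 0%C ->
  (forall z : C, Cmod z < 1 -> Cmod (w z) < 1) ->
  forall z : C, Cmod z < 1 -> Cmod (w z) <= Cmod z.
Proof.
intros Hw Hw0 Hw1 z0 Hz0.
destruct (Ceq_dec z0 0) as [-> | Hz0n]; [rewrite Hw0; lra |].
apply Rnot_lt_le; intros Hgt.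
assert (Hm0 := Cmod_pos _ Hz0n).
destruct (Hw 0%C) as [l Hl]; [rewrite Cmod_0; lra |].
set (k := fun z => if Ceq_dec z 0 then l else (w z / z)%C).
assert (Hk0 : k 0%C = l) by (unfold k; destruct Ceq_dec as [_ | E]; [reflexivity | now elim E]).
assert (Hkn : forall z : C, z <> 0%C -> k z = (w z / z)%C)
  by (intros z Hz; unfold k; destruct (Ceq_dec z 0) as [E | _]; [elim (Hz E) | reflexivity]).
assert (Hkd : forall z : C, z <> 0%C -> Cmod z < 1 -> exists m, cderiv k z m).
{ intros z Hz Hz1; destruct (Hw z Hz1) as [m Hm]; eexists.
  eapply (cderiv_ext_loc (fun y => w y / y)%C k z _ _ (Cmod z));
    [apply Cmod_pos, Hz | | reflexivity | apply cderiv_div; [exact Hz | exact Hm | apply cderiv_id]].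
  intros y Hy; symmetry; apply Hkn; intros ->.
  replace (0 - z)%C with (- z)%C in Hy by ring; rewrite Cmod_opp in Hy; lra. }
assert (Hkc0 : ccont k 0%C).
{ intros eps He; destruct (Hl (eps / 2)) as [d [Hd Hy]]; [lra |].
  exists d; split; [exact Hd |]; intros y Hyd.
  destruct (Ceq_dec y 0) as [-> | Hyn].
  - replace (k 0%C - k 0%C)%C with (RtoC 0) by ring; rewrite Cmod_0; exact He.
  - rewrite Hk0, (Hkn y Hyn); specialize (Hy y Hyd); rewrite Hw0 in Hy.
    assert (Hyp := Cmod_pos _ Hyn).
    replace (w y - 0 - (y - 0) * l)%C with ((w y / y - l) * y)%C in Hy by (field; exact Hyn).
    replace (y - 0)%C with y in Hy by ring.
    rewrite Cmod_mult in Hy; apply Rmult_le_reg_r in Hy; lra. }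
assert (Hkc : forall z : C, Cmod z < 1 -> ccont k z).
{ intros z Hz; destruct (Ceq_dec z 0) as [-> | Hzn]; [exact Hkc0 |].
  destruct (Hkd z Hzn Hz) as [m Hm]; apply cderiv_cont with m, Hm. }
assert (HK : Cmod (k z0) = Cmod (w z0) / Cmod z0) by (rewrite Hkn, Cmod_div by assumption; reflexivity).
set (K := Cmod (k z0)) in *.
assert (HK1 : K * Cmod z0 = Cmod (w z0)) by (rewrite HK; field; lra).
assert (HK2 : 1 < K) by nra.
(* Halfway between 1/K and 1: on the circle of radius [rho] the quotient |w z / z| is below 1/rho <
   K, so a small [eps] keeps the maximum off that circle. *)
set (rho := (Cmod z0 / Cmod (w z0) + 1) / 2).
assert (Hrw : Cmod z0 / Cmod (w z0) * K = 1) by (rewrite HK; field; lra).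
assert (Hw1z := Hw1 z0 Hz0).
assert (Hq : Cmod z0 < Cmod z0 / Cmod (w z0) < 1) by nra.
assert (Hrho : Cmod z0 < rho < 1) by (unfold rho; lra).
assert (HrK : 1 / rho < K).
{ apply Rmult_lt_reg_r with rho; [lra |]; unfold Rdiv; rewrite Rmult_assoc, Rinv_l by lra.
  unfold rho; nra. }
assert (Heps : exists eps, 0 < eps /\ 1 / rho + eps < K) by (exists ((K - 1 / rho) / 2); lra).
destruct Heps as [eps [Heps HepsK]].
set (v := fun r t => Cmod (k (polar 0 r t)) + eps * (r * r)).
assert (HPI := PI_RGT_0).
assert (Hmp : forall r t, 0 <= r -> Cmod (polar 0 r t) = r).
{ intros r t Hr; rewrite <- (Cmod_polar 0 r t Hr) at 2; f_equal; ring. }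
destruct (rect_max v 0 rho 0 (2 * PI)) as [r1 [t1 [[Hr1 Ht1] Hmax]]]; try lra.
{ intros r t [Hr Ht]; apply continuity_2d_pt_plus.
  - apply Cmod_polar_continuity, Hkc; rewrite Hmp; lra.
  - apply continuity_2d_pt_mult; [apply continuity_2d_pt_const |].
    apply continuity_2d_pt_mult; apply continuity_2d_pt_id1. }
set (z1 := polar 0 r1 t1) in *.
assert (Hz1 : Cmod z1 = r1) by (apply Hmp; lra).
assert (Hmax' : forall z : C, Cmod z <= rho ->
  Cmod (k z) + eps * (Cmod z * Cmod z) <= Cmod (k z1) + eps * (Cmod z1 * Cmod z1)).
{ intros z Hz; destruct (polar_surj z) as [t [Ht E]].
  assert (H0 := Cmod_ge_0 z).
  specialize (Hmax (Cmod z) t (conj (conj H0 Hz) Ht)); unfold v in Hmax.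
  rewrite <- E in Hmax; rewrite Hz1; exact Hmax. }
destruct (Rle_lt_or_eq_dec r1 rho) as [Hlt | Heq]; [lra | |].
- destruct (unit_phase (k z1)) as [c [Hc Hck]].
  (* The small disc about [z1] must avoid 0 except possibly as its centre, because [k] is only known
     to be continuous there. *)
  assert (Hdel : exists del, 0 < del /\ del + r1 <= rho /\
    forall z : C, 0 < Cmod (z - z1) <= del -> z <> 0%C).
  { destruct (Ceq_dec z1 0) as [Hz10 | Hz1n].
    - exists (rho - r1); repeat split; try lra.
      intros z [Hz _]; rewrite Hz10 in Hz; intros ->.
      replace (0 - 0)%C with (RtoC 0) in Hz by ring; rewrite Cmod_0 in Hz; lra.
    - assert (Hp := Cmod_pos _ Hz1n).
      exists (Rmin r1 (rho - r1) / 2).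
      assert (M0 := Rmin_pos r1 (rho - r1) (ltac:(lra)) (ltac:(lra))).
      assert (M1 := Rmin_l r1 (rho - r1)); assert (M2 := Rmin_r r1 (rho - r1)).
      repeat split; try lra.
      intros z [_ Hz] ->; replace (0 - z1)%C with (- z1)%C in Hz by ring.
      rewrite Cmod_opp in Hz; lra. }
  destruct Hdel as [del [Hdel [Hdr Hdn]]].
  assert (Hin : forall z, Cmod (z - z1) <= del -> Cmod z <= rho).
  { intros z Hz; assert (H := Cmod_minus_ge z z1); lra. }
  (* The real part of the linear term is eps (|z|^2 - |z1|^2 - |z - z1|^2). On the circle |z - z1| =
     del, maximality at [z1] thus gives Re f <= |k z1| - eps del^2, although Re f = |k z1| at the
     centre. *)
  set (f := fun z => (c * k z + RtoC (2 * eps) * Cconj z1 * (z - z1))%C).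
  assert (Hlin : forall z, cderiv (fun z => (RtoC (2 * eps) * Cconj z1 * (z - z1))%C) z
    (RtoC (2 * eps) * Cconj z1 * (1 - 0))%C).
  { intros z; apply cderiv_scal, cderiv_minus; [apply cderiv_id | apply cderiv_const]. }
  assert (HM : Re (f z1) <= Cmod (k z1) - eps * (del * del)).
  { apply mean_value_le with del.
    - exact Hdel.
    - intros z Hz; assert (Hz' := Hin z (proj2 Hz)).
      destruct (Hkd z (Hdn z Hz)) as [m Hm]; [lra |].
      eexists; apply cderiv_plus; [apply cderiv_scal, Hm | apply Hlin].
    - assert (Hz1' : Cmod z1 < 1) by lra.
      assert (A := Hkc z1 Hz1'); destruct (Ceq_dec z1 0) as [E | E].
      + intros e He; destruct (A (e / 2)) as [d1 [Hd1 A1]]; [lra |].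
        destruct (cderiv_cont _ _ _ (Hlin z1) (e / 2)) as [d2 [Hd2 A2]]; [lra |].
        exists (Rmin d1 d2); split; [apply Rmin_pos; assumption |].
        intros y Hy.
        specialize (A1 y (Rlt_le_trans _ _ _ Hy (Rmin_l _ _))).
        specialize (A2 y (Rlt_le_trans _ _ _ Hy (Rmin_r _ _))).
        unfold f.
        replace (_ - _)%C with (c * (k y - k z1) +
          (RtoC (2 * eps) * Cconj z1 * (y - z1) - RtoC (2 * eps) * Cconj z1 * (z1 - z1)))%C by ring.
        eapply Rle_lt_trans; [apply Cmod_triangle |]; rewrite Cmod_mult.
        assert (H := Cmod_ge_0 (k y - k z1)); nra.
      + destruct (Hkd z1 E Hz1') as [m Hm]; eapply cderiv_cont.
        apply cderiv_plus; [apply cderiv_scal, Hm | apply Hlin].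
    - intros z Hz.
      specialize (Hmax' z (Hin z (Req_le _ _ Hz))).
      unfold f; rewrite re_plus.
      assert (A1 := Re_le_Cmod (c * k z)); rewrite Cmod_mult in A1.
      assert (A2 := Cmod_ge_0 (k z)).
      assert (A3 := Cmod_sqr (z - z1)); rewrite Hz in A3.
      assert (A4 := Cmod_sqr z); assert (A5 := Cmod_sqr z1).
      assert (A6 : Re (RtoC (2 * eps) * Cconj z1 * (z - z1)) =
        eps * (Cmod z * Cmod z - Cmod z1 * Cmod z1 - del * del)).
      { rewrite A3, A4, A5; destruct z, z1; unfold Cconj, Cmult, Cminus, Cplus, Copp, RtoC, Re, Im; simpl; ring. }
      rewrite A6; nra. }
  unfold f in HM; rewrite Hck in HM.
  replace (RtoC (Cmod (k z1)) + _)%C with (RtoC (Cmod (k z1))) in HM by ring.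
  rewrite re_RtoC in HM; assert (H0 : 0 < eps * (del * del)) by (repeat apply Rmult_lt_0_compat; assumption); lra.
- specialize (Hmax' z0 (ltac:(lra))); fold K in Hmax'.
  assert (Hz1n : z1 <> 0%C) by (apply Cneq0_Cmod; lra).
  rewrite (Hkn z1 Hz1n), Cmod_div, Hz1, Heq in Hmax' by exact Hz1n.
  assert (A1 := Hw1 z1 (ltac:(lra))).
  assert (A2 : Cmod (w z1) / rho <= 1 / rho).
  { apply Rmult_le_compat_r; [apply Rlt_le, Rinv_0_lt_compat |]; lra. }
  assert (A3 : eps * (rho * rho) <= eps * 1) by (apply Rmult_le_compat_l; nra).
  assert (A4 : 0 <= eps * (Cmod z0 * Cmod z0)) by (apply Rmult_le_pos; nra).
  lra.
Qed.

(** * The image of a disc under phi_RL *)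

Definition ra : R := sqrt 2 - 1.
Definition rc : R := 2 * ra.

Lemma ra_sqr : ra * ra = 1 - rc.
Proof. assert (H := sqrt_sqrt 2 (ltac:(lra))); unfold rc, ra; nra. Qed.

Lemma ra_bounds : 4142 / 10000 < ra < 4143 / 10000.
Proof.
assert (H := sqrt_sqrt 2 (ltac:(lra))); assert (H0 := sqrt_pos 2); unfold ra; split; nra.
Qed.

Lemma rc_bounds : 8284 / 10000 < rc < 8286 / 10000.
Proof. assert (H := ra_bounds); unfold rc; lra. Qed.

Definition sq_arg (z : C) : C := ((1 - z) / (1 + rc * z))%C.

Definition sq (z : C) : C := Csqrt (sq_arg z).

Lemma phi_RL_sq (z : C) : phi_RL z = (1 + ra * (1 - sq z))%C.
Proof.
unfold phi_RL, sq, sq_arg, rc, ra.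
rewrite RtoC_mult, !RtoC_minus; ring.
Qed.

Lemma sq_den_neq0 (z : C) : Cmod z < 1 -> (1 + rc * z)%C <> 0%C.
Proof.
intros Hz H.
assert (Hc := rc_bounds).
assert (E : Cmod (rc * z) = 1).
{ replace (rc * z)%C with (- (1))%C; [rewrite Cmod_opp, Cmod_1; reflexivity |].
  replace (rc * z)%C with ((1 + rc * z) - 1)%C by ring; rewrite H; ring. }
rewrite Cmod_mult, Cmod_R, Rabs_pos_eq in E by lra.
assert (H0 := Cmod_ge_0 z); nra.
Qed.

Lemma sq_arg_inv (z : C) : Cmod z < 1 ->
  (1 - sq_arg z)%C = (z * (1 + rc * sq_arg z))%C.
Proof. intros Hz; assert (H := sq_den_neq0 z Hz); unfold sq_arg; field; exact H. Qed.

Lemma Re_pos_div (a b : C) : b <> 0%C -> 0 < Re (a * Cconj b) -> 0 < Re (a / b).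
Proof.
intros Hb H.
assert (Hm := Cmod_pos _ Hb).
replace (a / b)%C with (a * Cconj b * RtoC (/ (Cmod b * Cmod b)))%C.
- rewrite re_scal_r; apply Rmult_lt_0_compat; [exact H |].
  apply Rinv_0_lt_compat, Rmult_lt_0_compat; exact Hm.
- rewrite RtoC_inv by nra; rewrite RtoC_mult.
  assert (E := Cmod2_conj b); rewrite RtoC_pow in E.
  replace (Cmod b * Cmod b)%C with (Cmod b ^ 2)%C by ring; rewrite E; field.
  split; [exact Hb |]; intros E2; apply Hb.
  rewrite <- (Cconj_conj b), E2; unfold Cconj; simpl; rewrite Ropp_0; reflexivity.
Qed.

Lemma sq_arg_pos (z : C) : Cmod z < 1 -> 0 < Re (sq_arg z).
Proof.
intros Hz; apply Re_pos_div; [apply sq_den_neq0, Hz |].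
assert (Hc := rc_bounds).
assert (Hm := Cmod_sqr z); assert (Hx := Re_le_Cmod z); assert (H0 := Cmod_ge_0 z).
replace (Re _) with (1 - (1 - rc) * Re z - rc * (Cmod z * Cmod z)).
- assert (A1 : Cmod z * Cmod z < 1) by nra.
  assert (A2 : (1 - rc) * Re z <= (1 - rc) * Cmod z) by (apply Rmult_le_compat_l; lra).
  assert (A3 : (1 - rc) * Cmod z <= (1 - rc) * 1) by (apply Rmult_le_compat_l; lra).
  assert (A4 : rc * (Cmod z * Cmod z) < rc * 1) by (apply Rmult_lt_compat_l; lra).
  lra.
- rewrite Hm; destruct z as [x y]; unfold Cconj, Cminus, Cplus, Copp, Cmult, RtoC, Re, Im; simpl; ring.
Qed.

Lemma Csqrt_Re_pos (v : C) : 0 < Re v -> 0 < Re (Csqrt v).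
Proof.
intros H; unfold Csqrt; simpl; apply sqrt_lt_R0.
assert (H0 := Cmod_ge_0 v); lra.
Qed.

Lemma Cneq0_Re (z : C) : 0 < Re z -> z <> 0%C.
Proof. intros H ->; simpl in H; lra. Qed.

Lemma cderiv_Csqrt (v : C) : 0 < Re v -> cderiv Csqrt v (/ (2 * Csqrt v))%C.
Proof.
intros Hv.
assert (Hs := Csqrt_Re_pos v Hv).
assert (Hs0 := Cneq0_Re _ Hs).
apply cderiv_eq with (1 / (1 * Csqrt v + Csqrt v * 1))%C.
{ field; split; [exact Hs0 |].
  apply Cneq0_Re; rewrite re_plus; lra. }
apply cderiv_lift with (g := fun s => (s * s)%C) (h := fun y => y) (r := 1).
- lra.
- intros y _; apply Csqrt_sqr.
- intros eps He.
  assert (Hd : 0 < eps * Re (Csqrt v)) by (apply Rmult_lt_0_compat; assumption).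
  exists (eps * Re (Csqrt v)); split; [exact Hd |]; intros y Hy.
  (* Principal roots have nonnegative real part, so the modulus of the sum of the two roots is at
     least Re (Csqrt v) > 0. *)
  replace (y - v)%C with ((Csqrt y - Csqrt v) * (Csqrt y + Csqrt v))%C in Hy.
  2:{ rewrite <- (Csqrt_sqr y), <- (Csqrt_sqr v) at 3; ring. }
  rewrite Cmod_mult in Hy.
  assert (Hp := proj1 (Csqrt_principal y)).
  assert (Hr := Re_le_Cmod (Csqrt y + Csqrt v)); rewrite re_plus in Hr.
  assert (H0 := Cmod_ge_0 (Csqrt y - Csqrt v)).
  apply Rmult_lt_reg_r with (Re (Csqrt v)); [exact Hs |]; nra.
- apply (cderiv_mult (fun s => s) (fun s => s)); apply cderiv_id.
- apply Cneq0_Re.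
  replace (1 * Csqrt v + Csqrt v * 1)%C with (Csqrt v + Csqrt v)%C by ring.
  rewrite re_plus; lra.
- apply cderiv_id.
Qed.

Lemma sq_Re_pos (z : C) : Cmod z < 1 -> 0 < Re (sq z).
Proof. intros Hz; apply Csqrt_Re_pos, sq_arg_pos, Hz. Qed.

Lemma cderiv_sq (z : C) : Cmod z < 1 ->
  cderiv sq z (- (1 + rc) / (2 * sq z * ((1 + rc * z) * (1 + rc * z))))%C.
Proof.
intros Hz.
assert (Hd := sq_den_neq0 z Hz).
assert (Hs := Cneq0_Re _ (sq_Re_pos z Hz)).
assert (H2 : RtoC 2 <> 0%C) by (intros E; injection E; lra).
eapply cderiv_eq; [| apply (cderiv_comp Csqrt sq_arg);
  [apply cderiv_Csqrt, sq_arg_pos, Hz | apply cderiv_div;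
   [exact Hd | apply cderiv_minus; [apply cderiv_const | apply cderiv_id] |
    apply cderiv_plus; [apply cderiv_const | apply cderiv_scal, cderiv_id]]]].
fold (sq z); cbv beta; field; repeat split; assumption.
Qed.

Lemma phi_RL_analytic : analytic_on_disk phi_RL.
Proof.
apply cderiv_analytic; intros z Hz; eexists.
eapply (cderiv_ext_loc (fun z => 1 + ra * (1 - sq z))%C phi_RL z _ _ 1);
  [lra | intros y _; symmetry; apply phi_RL_sq | reflexivity |].
apply cderiv_plus; [apply cderiv_const | apply cderiv_scal, cderiv_minus;
  [apply cderiv_const | apply cderiv_sq, Hz]].
Qed.

Definition rsq (x : R) : R := sqrt ((1 - x) / (1 + rc * x)).

Lemma rsq_pos (x : R) : -1 <= x < 1 -> 0 < rsq x.
Proof.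
intros Hx; assert (Hc := rc_bounds); apply sqrt_lt_R0, Rdiv_lt_0_compat; nra.
Qed.

Lemma rsq_sqr (x : R) : -1 <= x <= 1 -> rsq x * rsq x = (1 - x) / (1 + rc * x).
Proof.
intros Hx; assert (Hc := rc_bounds); apply sqrt_sqrt.
apply Rmult_le_pos; [lra |]; apply Rlt_le, Rinv_0_lt_compat; nra.
Qed.

Lemma rsq_inv (x : R) : -1 <= x <= 1 -> x * (1 + rc * (rsq x * rsq x)) = 1 - rsq x * rsq x.
Proof.
intros Hx; assert (Hc := rc_bounds); rewrite rsq_sqr by exact Hx; field; nra.
Qed.

(* The square of [s1 + i s2] lies in the disc with diameter [[A^2, B^2]]; the
   conclusion places [s1 + i s2] in the disc with diameter [[A, B]]. *)
Lemma sqrt_disc (A B s1 s2 : R) :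
  0 < A -> A <= B -> 0 < s1 ->
  let n := s1 * s1 + s2 * s2 in
  n * n + A * A * (B * B) <= (A * A + B * B) * (s1 * s1 - s2 * s2) ->
  n + A * B <= (A + B) * s1.
Proof.
intros HA HAB Hs n Hn.
set (x := s1 * s1); assert (Hx : 0 < x) by (unfold x; nra).
assert (Hy : s2 * s2 = n - x) by (unfold n, x; ring).
rewrite Hy in Hn; fold x in Hn.
assert (Hn0 : x <= n) by (unfold n, x; nra).
assert (HS : 0 < A * A + B * B) by nra.
assert (Hx2 : (n + A * A) * (n + B * B) <= 2 * (A * A + B * B) * x) by nra.
assert (Hn1 : (n - A * A) * (n - B * B) <= 0) by nra.
(* [Hx2] bounds x from below, and the squared goal is (n + A B)^2 <= (A + B)^2 x. The identity shows
   that the former implies the latter because A^2 <= n <= B^2, which is [Hn1]. *)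
assert (Hid : (A + B) * (A + B) * ((n + A * A) * (n + B * B)) -
  2 * (A * A + B * B) * ((n + A * B) * (n + A * B)) =
  (A - B) * (A - B) * - ((n - A * A) * (n - B * B))) by ring.
assert (Hpos : 0 <= (A - B) * (A - B) * - ((n - A * A) * (n - B * B))).
{ apply Rmult_le_pos; [apply Rle_0_sqr | lra]. }
assert (Hsq : (n + A * B) * (n + A * B) <= (A + B) * (A + B) * x).
{ apply Rmult_le_reg_l with (2 * (A * A + B * B)); [lra |].
  apply Rle_trans with ((A + B) * (A + B) * ((n + A * A) * (n + B * B))); [lra |].
  replace (2 * (A * A + B * B) * ((A + B) * (A + B) * x)) with
    ((A + B) * (A + B) * (2 * (A * A + B * B) * x)) by ring.
  apply Rmult_le_compat_l; [apply Rle_0_sqr | exact Hx2]. }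
assert (HAB0 : 0 < A * B) by (apply Rmult_lt_0_compat; lra).
assert (HABs : 0 < (A + B) * s1) by (apply Rmult_lt_0_compat; lra).
apply Rsqr_incr_0_var; [| lra].
unfold Rsqr; replace ((A + B) * s1 * ((A + B) * s1)) with ((A + B) * (A + B) * x) by (unfold x; ring).
exact Hsq.
Qed.

(** For v = [sq_arg z] the relation 1 - v = z (1 + c v) gives |1 - v| <= r |1 + c v|, an Apollonius
    disc symmetric about the real axis. It meets the axis at the values of v at r and -r, which are
    A^2 and B^2, so [sqrt_disc] applies. *)
Lemma sq_disc (z : C) (r : R) : Cmod z <= r -> r < 1 ->
  let A := rsq r in let B := rsq (- r) in
  Re (sq z) * Re (sq z) + Im (sq z) * Im (sq z) + A * B <= (A + B) * Re (sq z).
Proof.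
intros Hz Hr A B.
assert (Hc := rc_bounds); assert (Hz0 := Cmod_ge_0 z).
assert (HA : A * A = (1 - r) / (1 + rc * r)) by (apply rsq_sqr; lra).
assert (HB : B * B = (1 + r) / (1 - rc * r)).
{ unfold B; rewrite rsq_sqr by lra; f_equal; ring. }
assert (HA0 : 0 < A) by (apply rsq_pos; lra).
assert (HB0 : 0 < B) by (apply rsq_pos; lra).
assert (Hd1 : 0 < 1 + rc * r) by nra; assert (Hd2 : 0 < 1 - rc * r) by nra.
apply sqrt_disc; [exact HA0 | | apply sq_Re_pos; lra |].
- apply sqrt_le_1_alt.
  apply Rle_trans with 1; [apply Rle_div_l; nra | apply Rle_div_r; nra].
- assert (E := sq_arg_inv z (ltac:(lra))).
  apply (f_equal Cmod) in E; rewrite Cmod_mult in E.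
  assert (E1 := Cmod_sqr (1 - sq_arg z)); assert (E2 := Cmod_sqr (1 + rc * sq_arg z)).
  rewrite E in E1.
  assert (G := Cmod_ge_0 (1 + rc * sq_arg z)).
  set (M := Cmod (1 + rc * sq_arg z)) in *; clearbody M.
  rewrite <- (Csqrt_sqr (sq_arg z)) in E1, E2; fold (sq z) in E1, E2.
  destruct (sq z) as [s1 s2]; simpl in E1, E2 |- *.
  assert (E3 : Cmod z * M * (Cmod z * M) <= r * r * (M * M)).
  { replace (Cmod z * M * (Cmod z * M)) with (Cmod z * Cmod z * (M * M)) by ring.
    apply Rmult_le_compat_r; [apply Rle_0_sqr | apply Rmult_le_compat; lra]. }
  rewrite E1, E2 in E3; clear E1 E2 E G M.
  rewrite HA, HB.
  set (x := s1 * s1 - s2 * s2); set (n := s1 * s1 + s2 * s2).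
  apply Rmult_le_reg_r with ((1 + rc * r) * (1 - rc * r)); [apply Rmult_lt_0_compat; assumption |].
  replace ((n * n + (1 - r) / (1 + rc * r) * ((1 + r) / (1 - rc * r))) * ((1 + rc * r) * (1 - rc * r)))
    with (n * n * ((1 + rc * r) * (1 - rc * r)) + (1 - r) * (1 + r)) by (field; lra).
  replace (((1 - r) / (1 + rc * r) + (1 + r) / (1 - rc * r)) * x * ((1 + rc * r) * (1 - rc * r)))
    with (((1 - r) * (1 - rc * r) + (1 + r) * (1 + rc * r)) * x) by (field; lra).
  unfold n, x; clear -E3; lra.
Qed.

(** The primitive Q in the variable s: substituting x = (1 - s^2)/(1 + c s^2) turns h(x) dx / x into
    the rational form of [Lam_derive], whose partial fractions give the two logarithms and the
    arctangent. *)
Definition Lam (s : R) : R :=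
  rc * ln (1 + s) - ra * ln (1 + rc * (s * s)) - sqrt rc * atan (sqrt rc * s).

Lemma Lam_derive (s : R) : 0 <= s ->
  is_derive Lam s (- (rc * (1 + rc) * s / ((1 + s) * (1 + rc * (s * s))))).
Proof.
intros Hs; assert (Hc := rc_bounds).
assert (Hk : sqrt rc * sqrt rc = rc) by (apply sqrt_sqrt; lra).
assert (Hcs : 0 < 1 + rc * (s * s)) by nra.
unfold Lam; auto_derive; [repeat split; lra |].
replace (sqrt rc * s * (sqrt rc * s * 1)) with (sqrt rc * sqrt rc * (s * s)) by ring.
rewrite Hk.
replace (sqrt rc * (sqrt rc * 1 * / (1 + rc * (s * s)))) with
  (sqrt rc * sqrt rc * / (1 + rc * (s * s))) by ring.
rewrite Hk; replace ra with (rc / 2) by (unfold rc; lra); field; lra.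
Qed.

Lemma Lam_decr (s t : R) : 0 <= s < t -> Lam t < Lam s.
Proof.
intros Hst; assert (Hc := rc_bounds).
destruct (MVT_cor2 Lam (fun s => - (rc * (1 + rc) * s / ((1 + s) * (1 + rc * (s * s))))) s t)
  as [m [Hm Hmi]]; [lra | intros u Hu; apply is_derive_Reals, Lam_derive; lra |].
assert (Hm2 : 0 <= rc * (m * m)) by (repeat first [lra | apply Rmult_le_pos]).
assert (Hp : 0 < rc * (1 + rc) * m / ((1 + m) * (1 + rc * (m * m)))).
{ apply Rdiv_lt_0_compat; repeat first [lra | apply Rmult_lt_0_compat]. }
assert (Hpt := Rmult_lt_0_compat _ (t - s) Hp (ltac:(lra))); lra.
Qed.

Definition Qr (x : R) : R := Lam (rsq x) - Lam 1.

Lemma Qr_0 : Qr 0 = 0.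
Proof.
unfold Qr, rsq; replace ((1 - 0) / (1 + rc * 0)) with 1 by field; rewrite sqrt_1; ring.
Qed.

(** This is h(x)/x with the factor x cancelled, using 1 - s^2 = x (1 + c s^2); in this shape it also
    holds at x = 0. *)
Lemma Qr_derive (x : R) : -1 < x < 1 ->
  is_derive Qr x (ra * (1 + rc * (rsq x * rsq x)) / (1 + rsq x)).
Proof.
intros Hx; assert (Hc := rc_bounds).
assert (Hs := rsq_pos x (ltac:(lra))).
assert (Hd : 0 < 1 + rc * x) by nra.
assert (Hs2 := rsq_sqr x (ltac:(lra))).
assert (Hcs : 0 < 1 + rc * (rsq x * rsq x)) by nra.
assert (Hr : is_derive rsq x (- (1 + rc) / (2 * rsq x * ((1 + rc * x) * (1 + rc * x))))).
{ unfold rsq at 1; auto_derive; [split; [lra | split; [| exact I]]; apply Rdiv_lt_0_compat; lra |].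
  change (sqrt ((1 + - x) * / (1 + rc * x))) with (rsq x); field; lra. }
assert (H := is_derive_comp Lam rsq x _ _ (Lam_derive (rsq x) (Rlt_le _ _ Hs)) Hr).
assert (H2 := is_derive_minus _ _ _ _ _ H (is_derive_const (Lam 1) x)).
apply (is_derive_ext (fun x => minus (Lam (rsq x)) (Lam 1))); [reflexivity |].
match type of H2 with is_derive _ _ ?l => replace (ra * _ / _) with l; [exact H2 |] end.
unfold minus, plus, opp, zero, scal; simpl; unfold mult; simpl.
assert (E : 1 + rc * x = (1 + rc) / (1 + rc * (rsq x * rsq x))) by (rewrite Hs2; field; lra).
rewrite E; replace ra with (rc / 2) by (unfold rc; lra).
field; lra.
Qed.

Lemma Qr_derive_mul (x : R) : -1 < x < 1 ->
  x * (ra * (1 + rc * (rsq x * rsq x)) / (1 + rsq x)) = ra * (1 - rsq x).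
Proof.
intros Hx.
assert (Hs := rsq_pos x (ltac:(lra))).
replace (x * (ra * (1 + rc * (rsq x * rsq x)) / (1 + rsq x))) with
  (ra * (x * (1 + rc * (rsq x * rsq x))) / (1 + rsq x)) by (field; lra).
rewrite rsq_inv by lra; field; lra.
Qed.

(** * Integration along rays *)

(* [z] lies in the closed disc with diameter [[-Y, X]]. *)
Definition in_disc (X Y : R) (z : C) : Prop :=
  Im z * Im z <= (X - Re z) * (Re z + Y).

(** The half-planes are the supporting ones, and the normal pointing from the centre to [z] bounds
    the distance by the radius. Each half-plane involves a single real functional of [z], to which
    the real mean value theorem applies. *)
Lemma in_disc_halfplanes (X Y : R) (z : C) :
  (forall p q, p * p + q * q = 1 ->
     p * Re z + q * Im z <= p * ((X - Y) / 2) + (X + Y) / 2) ->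
  in_disc X Y z.
Proof.
intros H; unfold in_disc.
set (x := Re z) in *; set (y := Im z) in *.
set (u := x - (X - Y) / 2).
destruct (Req_dec (u * u + y * y) 0) as [H0 | H0].
- assert (H1 := H 1 0 (ltac:(ring))); assert (H2 := H (-1) 0 (ltac:(ring))).
  unfold u in H0; nra.
- set (m := sqrt (u * u + y * y)).
  assert (Hpos : 0 < u * u + y * y) by nra.
  assert (Hm : m * m = u * u + y * y) by (apply sqrt_sqrt; lra).
  assert (Hm0 : 0 < m) by (apply sqrt_lt_R0; exact Hpos).
  assert (H1 := H (u / m) (y / m)).
  assert (E1 : u / m * (u / m) + y / m * (y / m) = 1).
  { replace (u / m * (u / m) + y / m * (y / m)) with ((u * u + y * y) / (m * m)) by (field; lra).
    rewrite <- Hm; field; lra. }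
  specialize (H1 E1).
  assert (E2 : u / m * u + y / m * y = m).
  { replace (u / m * u + y / m * y) with ((u * u + y * y) / m) by (field; lra).
    rewrite <- Hm; field; lra. }
  assert (H2 : m <= (X + Y) / 2).
  { rewrite <- E2; unfold u at 2; lra. }
  assert (H3 : m * m <= (X + Y) / 2 * ((X + Y) / 2)) by (apply Rmult_le_compat; lra).
  rewrite Hm in H3; unfold u in H3; lra.
Qed.

Lemma sq_halfplane (z : C) (r p q : R) : Cmod z <= r -> r < 1 -> p * p + q * q = 1 ->
  p * (ra * (1 - Re (sq z))) + q * (- ra * Im (sq z)) <=
  p * ((ra * (1 - rsq r) + ra * (1 - rsq (- r))) / 2) + (ra * (1 - rsq r) - ra * (1 - rsq (- r))) / 2.
Proof.
intros Hz Hr Hpq.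
assert (H := sq_disc z r Hz Hr); cbv zeta in H.
set (A := rsq r) in *; set (B := rsq (- r)) in *.
set (s1 := Re (sq z)) in *; set (s2 := Im (sq z)) in *.
assert (Hz0 := Cmod_ge_0 z); assert (Hc := rc_bounds).
assert (HAB : A <= B).
{ apply sqrt_le_1_alt; apply Rle_trans with 1; [apply Rle_div_l; nra | apply Rle_div_r; nra]. }
set (u := s1 - (A + B) / 2).
assert (Hu : u * u + s2 * s2 <= (B - A) / 2 * ((B - A) / 2)) by (unfold u; nra).
assert (Hcs : - (p * u + q * s2) <= (B - A) / 2).
{ apply Rsqr_incr_0_var; [| lra]; unfold Rsqr.
  apply Rle_trans with ((p * p + q * q) * (u * u + s2 * s2)); [| rewrite Hpq; lra].
  assert (0 <= (p * s2 - q * u) * (p * s2 - q * u)) by apply Rle_0_sqr; lra. }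
assert (Ha := ra_bounds).
apply (Rmult_le_compat_l ra) in Hcs; [| lra].
unfold u in Hcs; lra.
Qed.

Lemma derive_along_ray (V : C -> C) (z l : C) (t p q : R) :
  cderiv V (t * z)%C l ->
  is_derive (fun t : R => p * Re (V (t * z)%C) + q * Im (V (t * z)%C)) t
    (p * Re (z * l) + q * Im (z * l)).
Proof.
intros H; destruct z as [x y].
assert (E : forall u : R, (u * (x, y))%C = (u * x, u * y)).
{ intros u; unfold Cmult, RtoC; simpl; f_equal; ring. }
rewrite E in H; destruct (cderiv_differentiable V _ _ l H) as [HR HI].
assert (D : forall k, derivable_pt_lim (fun u => u * k) t k).
{ intros k; apply is_derive_Reals; auto_derive; [exact I | ring]. }
assert (D1 := derivable_pt_lim_comp_2d _ (fun u => u * x) (fun u => u * y) t _ _ _ _ HR (D x) (D y)).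
assert (D2 := derivable_pt_lim_comp_2d _ (fun u => u * x) (fun u => u * y) t _ _ _ _ HI (D x) (D y)).
apply is_derive_Reals in D1; apply is_derive_Reals in D2.
apply (is_derive_ext (fun u => plus (scal p (Re (V (u * x, u * y)))) (scal q (Im (V (u * x, u * y)))))).
{ intros u; rewrite E; reflexivity. }
replace (p * Re ((x, y) * l) + q * Im ((x, y) * l)) with
  (plus (scal p (Re l * x + - Im l * y)) (scal q (Im l * x + Re l * y))).
- apply @is_derive_plus; apply @is_derive_scal; assumption.
- destruct l as [l1 l2]; unfold plus, scal; simpl; unfold mult; simpl; unfold Re, Im; simpl; ring.
Qed.

(* Along the ray the derivative of [V] lies in [1/t] times the disc with diameter
   [[h(-tr), h(tr)]], and both end points integrate to values of [Qr]. *)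
Lemma ray_disc (V w : C -> C) (z : C) :
  Cmod z < 1 ->
  (forall y, Cmod y < 1 -> Cmod (w y) <= Cmod y) ->
  V 0%C = 0%C ->
  (forall t : R, 0 <= t <= 1 -> exists l, cderiv V (t * z)%C l /\
     (t * z * l)%C = (ra * (1 - sq (w (t * z))))%C) ->
  in_disc (Qr (Cmod z)) (- Qr (- Cmod z)) (V z).
Proof.
intros Hz Hw HV0 HV.
set (r := Cmod z); assert (Hr0 : 0 <= r) by apply Cmod_ge_0; fold r in Hz.
apply in_disc_halfplanes; intros p q Hpq.
set (dQ := fun x => ra * (1 + rc * (rsq x * rsq x)) / (1 + rsq x)).
(* [T] is the excess of the functional of V over the support function of the disc with diameter from
   Qr(-tr) to Qr(tr). *)
set (T := fun t : R => (p * Re (V (t * z)%C) + q * Im (V (t * z)%C))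
  - (p * ((Qr (t * r) + Qr (t * - r)) / 2) + (Qr (t * r) - Qr (t * - r)) / 2)).
set (T' := fun t : R => (p * Re (z * C_derive V (t * z)%C) + q * Im (z * C_derive V (t * z)%C))
  - (p * ((r * dQ (t * r) + - r * dQ (t * - r)) / 2) +
     (r * dQ (t * r) - - r * dQ (t * - r)) / 2)).
assert (HT : forall t, 0 <= t <= 1 -> derivable_pt_lim T t (T' t)).
{ intros t Ht; apply is_derive_Reals.
  destruct (HV t Ht) as [l [Hl _]].
  assert (H1 := derive_along_ray V z l t p q Hl).
  rewrite <- (cderiv_unique _ _ _ Hl) in H1.
  assert (HQ : forall k, -1 < t * k < 1 -> is_derive (fun t => Qr (t * k)) t (k * dQ (t * k))).
  { intros k Hk.
    apply (is_derive_comp Qr (fun t => t * k)); [apply Qr_derive; exact Hk |].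
    auto_derive; [exact I | ring]. }
  assert (H2 := HQ r (ltac:(nra))); assert (H3 := HQ (- r) (ltac:(nra))).
  unfold T, T'.
  apply @is_derive_minus; [exact H1 |].
  set (Q1 := fun t => Qr (t * r)) in *; set (Q2 := fun t => Qr (t * - r)) in *.
  change (is_derive (fun t => p * ((Q1 t + Q2 t) / 2) + (Q1 t - Q2 t) / 2) t
    (p * ((r * dQ (t * r) + - r * dQ (t * - r)) / 2) +
     (r * dQ (t * r) - - r * dQ (t * - r)) / 2)).
  auto_derive.
  - repeat split; eexists; eassumption.
  - assert (E1 : Derive (fun x => Q1 x) t = r * dQ (t * r)) by exact (is_derive_unique _ _ _ H2).
    assert (E2 : Derive (fun x => Q2 x) t = - r * dQ (t * - r)) by exact (is_derive_unique _ _ _ H3).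
    rewrite E1, E2; field. }
destruct (MVT_cor2 T T' 0 1 Rlt_0_1 HT) as [t [HTt Ht]].
(* The mean value point is positive, so the sign can be checked after multiplication by [t], which
   turns every derivative into a value of h. *)
assert (HT'0 : T' t <= 0).
{ apply Rmult_le_reg_l with t; [lra |]; rewrite Rmult_0_r.
  destruct (HV t (ltac:(lra))) as [l [Hl Hv]].
  unfold T'; rewrite (cderiv_unique _ _ _ Hl).
  assert (Htz : Cmod (t * z) = t * r) by (rewrite Cmod_mult, Cmod_R, Rabs_pos_eq by lra; reflexivity).
  assert (Hwt := Hw (t * z)%C (ltac:(rewrite Htz; nra))); rewrite Htz in Hwt.
  assert (HH := sq_halfplane (w (t * z)%C) (t * r) p q Hwt (ltac:(nra)) Hpq).
  rewrite <- (Qr_derive_mul (t * r)) in HH by nra.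
  replace (- (t * r)) with (t * - r) in HH by ring.
  rewrite <- (Qr_derive_mul (t * - r)) in HH by nra.
  fold (dQ (t * r)) (dQ (t * - r)) in HH.
  rewrite <- Cmult_assoc in Hv.
  assert (E1 := f_equal Re Hv); assert (E2 := f_equal Im Hv).
  rewrite re_scal_l, re_scal_l in E1; rewrite im_scal_l, im_scal_l in E2.
  unfold Cminus in E1, E2; rewrite re_plus, re_opp, re_RtoC in E1.
  rewrite im_plus, im_opp, im_RtoC in E2.
  set (a1 := Re (z * l)) in *; set (a2 := Im (z * l)) in *.
  replace (1 + - Re (sq (w (t * z)%C))) with (1 - Re (sq (w (t * z)%C))) in E1 by ring.
  rewrite <- E1 in HH.
  replace (- ra * Im (sq (w (t * z)%C))) with (t * a2) in HH by lra.
  lra. }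
assert (HT0 : T 0 = 0).
{ unfold T; rewrite !Rmult_0_l, Qr_0, Cmult_0_l, HV0; simpl; field. }
assert (HT1 : T 1 <= 0) by lra.
unfold T in HT1; rewrite !Rmult_1_l, Cmult_1_l in HT1; lra.
Qed.

(** [qpos] is Q(1) and [qneg] is -Q(-1): the variable s is 0 at x = 1 and 2 + sqrt 2 at x = -1. *)
Definition qpos : R := Lam 0 - Lam 1.
Definition qneg : R := Lam 1 - Lam (2 + sqrt 2).

Lemma rsq_m1 : rsq (-1) = 2 + sqrt 2.
Proof.
assert (H2 := sqrt_sqrt 2 (ltac:(lra))); assert (H0 := sqrt_pos 2); assert (Hc := rc_bounds).
unfold rsq; replace ((1 - -1) / (1 + rc * -1)) with (Rsqr (2 + sqrt 2)).
- apply sqrt_Rsqr; lra.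
- unfold Rsqr; apply Rmult_eq_reg_r with (1 + rc * -1); [| lra].
  replace ((1 - -1) / (1 + rc * -1) * (1 + rc * -1)) with 2 by (field; lra).
  unfold rc, ra; nra.
Qed.

Lemma rsq_decr (x y : R) : -1 <= x -> x < y -> y <= 1 -> rsq y < rsq x.
Proof.
intros Hx Hxy Hy; assert (Hc := rc_bounds).
assert (Hd1 : 0 < 1 + rc * x) by nra; assert (Hd2 : 0 < 1 + rc * y) by nra.
apply sqrt_lt_1_alt; split.
- apply Rmult_le_pos; [lra | apply Rlt_le, Rinv_0_lt_compat, Hd2].
- apply Rmult_lt_reg_r with ((1 + rc * x) * (1 + rc * y)); [apply Rmult_lt_0_compat; assumption |].
  replace ((1 - y) / (1 + rc * y) * ((1 + rc * x) * (1 + rc * y))) with ((1 - y) * (1 + rc * x)) by (field; lra).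
  replace ((1 - x) / (1 + rc * x) * ((1 + rc * x) * (1 + rc * y))) with ((1 - x) * (1 + rc * y)) by (field; lra).
  nra.
Qed.

Lemma rsq_0 : rsq 0 = 1.
Proof. unfold rsq; replace ((1 - 0) / (1 + rc * 0)) with 1 by field; apply sqrt_1. Qed.

Lemma Qr_range_pos (r : R) : 0 <= r < 1 -> 0 <= Qr r < qpos.
Proof.
intros Hr; unfold Qr, qpos.
assert (Hp := rsq_pos r (ltac:(lra))).
assert (H1 := Lam_decr 0 (rsq r) (ltac:(lra))).
destruct (Req_dec r 0) as [-> | Hn].
- rewrite rsq_0 in *; lra.
- assert (H2 := rsq_decr 0 r (ltac:(lra)) (ltac:(lra)) (ltac:(lra))); rewrite rsq_0 in H2.
  assert (H3 := Lam_decr (rsq r) 1 (ltac:(lra))); lra.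
Qed.

Lemma Qr_range_neg (r : R) : 0 <= r < 1 -> 0 <= - Qr (- r) < qneg.
Proof.
intros Hr; unfold Qr, qneg.
assert (H0 := rsq_decr (-1) (- r) (ltac:(lra)) (ltac:(lra)) (ltac:(lra))); rewrite rsq_m1 in H0.
assert (Hp := rsq_pos (- r) (ltac:(lra))).
assert (H1 := Lam_decr (rsq (- r)) (2 + sqrt 2) (ltac:(lra))).
destruct (Req_dec r 0) as [-> | Hn].
- rewrite Ropp_0, rsq_0 in *; lra.
- assert (H2 := rsq_decr (- r) 0 (ltac:(lra)) (ltac:(lra)) (ltac:(lra))); rewrite rsq_0 in H2.
  assert (H3 := Lam_decr 1 (rsq (- r)) (ltac:(lra))); lra.
Qed.

(** * Closed forms and numerical bounds *)

Lemma ln_sqrt (x : R) : 0 < x -> ln (sqrt x) = ln x / 2.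
Proof.
intros Hx; rewrite <- (sqrt_sqrt x) at 2 by lra.
rewrite ln_mult by (apply sqrt_lt_R0; exact Hx); field.
Qed.

Lemma Lam_0 : Lam 0 = 0.
Proof.
unfold Lam; rewrite !Rmult_0_r, !Rplus_0_r, ln_1, atan_0; ring.
Qed.

Lemma qpos_eq : qpos = rc * ln (1 / 2 * sqrt (rc + 1)) + g0 1.
Proof.
assert (Hc := rc_bounds).
assert (Hs : 0 < sqrt (1 + rc)) by (apply sqrt_lt_R0; lra).
unfold qpos; rewrite Lam_0; unfold Lam, g0.
change (2 * (sqrt 2 - 1)) with rc.
rewrite Rminus_diag, sqrt_0, Rmult_0_r, Rplus_0_l, Rminus_0_r, !Rmult_1_r.
rewrite (Rplus_comm rc 1).
replace (sqrt rc * sqrt (1 + rc) / sqrt (1 + rc)) with (sqrt rc) by (field; lra).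
replace (1 / 2 * sqrt (1 + rc)) with (/ 2 * sqrt (1 + rc)) by field.
rewrite ln_mult, ln_Rinv, ln_sqrt by lra.
replace (1 + 1) with 2 by ring.
replace ra with (rc / 2) by (unfold rc; lra); field.
Qed.

Lemma atan_diff (u v : R) : 0 <= v <= u -> atan u - atan v = atan ((u - v) / (1 + u * v)).
Proof.
intros H; assert (HPI := PI_RGT_0).
assert (Hu := atan_bound u); assert (Hv := atan_bound v).
assert (Hmono : atan v <= atan u).
{ destruct (Req_dec v u) as [-> | Hn]; [lra | apply Rlt_le, atan_increasing; lra]. }
assert (Hv0 : 0 <= atan v).
{ rewrite <- atan_0; destruct (Req_dec 0 v) as [<- | Hn]; [lra | apply Rlt_le, atan_increasing; lra]. }
assert (E := atan_sub_correct u v (ltac:(nra)) (ltac:(lra)) (atan_bound _)).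
unfold atan_sub in E; lra.
Qed.

Lemma sqrt_1_minus_rc : sqrt (1 - rc) = ra.
Proof.
rewrite <- ra_sqr; apply sqrt_Rsqr; assert (H := ra_bounds); lra.
Qed.

(** The two arctangents merge by the subtraction formula. Both logarithms contain a power of 1/a,
    and these contributions cancel because c = 2a. The result is the shape of [g0 (-1)] and is
    easier to estimate. *)
Lemma qneg_alt : qneg = sqrt rc * atan (sqrt rc / (3 - sqrt 2)) - rc * ln (sqrt 2 - 1 / 2).
Proof.
assert (Hc := rc_bounds); assert (Ha := ra_bounds).
assert (H2 := sqrt_sqrt 2 (ltac:(lra))); assert (H0 := sqrt_pos 2).
assert (Hs2 : sqrt 2 = 1 + ra) by (unfold ra; ring).
assert (Haa := ra_sqr); assert (Hrc : rc = 2 * ra) by reflexivity.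
assert (Hk : sqrt rc * sqrt rc = rc) by (apply sqrt_sqrt; lra).
assert (Hk0 : 0 < sqrt rc) by (apply sqrt_lt_R0; lra).
assert (E1 : atan (sqrt rc * (2 + sqrt 2)) - atan (sqrt rc * 1) = atan (sqrt rc / (3 - sqrt 2))).
{ rewrite atan_diff by nra.
  f_equal.
  replace (1 + sqrt rc * (2 + sqrt 2) * (sqrt rc * 1)) with (1 + sqrt rc * sqrt rc * (2 + sqrt 2)) by ring.
  rewrite Hk.
  apply Rmult_eq_reg_r with ((1 + rc * (2 + sqrt 2)) * (3 - sqrt 2)); [| nra].
  replace ((sqrt rc * (2 + sqrt 2) - sqrt rc * 1) / (1 + rc * (2 + sqrt 2)) * ((1 + rc * (2 + sqrt 2)) * (3 - sqrt 2)))
    with (sqrt rc * ((1 + sqrt 2) * (3 - sqrt 2))) by (field; nra).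
  replace (sqrt rc / (3 - sqrt 2) * ((1 + rc * (2 + sqrt 2)) * (3 - sqrt 2)))
    with (sqrt rc * (1 + rc * (2 + sqrt 2))) by (field; nra).
  f_equal; rewrite Hrc, Hs2; nra. }
assert (E2 : 1 + rc * ((2 + sqrt 2) * (2 + sqrt 2)) = (1 + rc) / (ra * ra)).
{ apply Rmult_eq_reg_r with (ra * ra); [| nra].
  replace ((1 + rc) / (ra * ra) * (ra * ra)) with (1 + rc) by (field; lra).
  rewrite Hs2; rewrite Hrc in *; nra. }
assert (E3 : 1 + (2 + sqrt 2) = 2 * (sqrt 2 - 1 / 2) / ra).
{ apply Rmult_eq_reg_r with ra; [| lra].
  replace (2 * (sqrt 2 - 1 / 2) / ra * ra) with (2 * (sqrt 2 - 1 / 2)) by (field; lra).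
  rewrite Hs2; rewrite Hrc in *; nra. }
unfold qneg, Lam; rewrite E2, E3, <- E1.
assert (L1 : ln (2 * (sqrt 2 - 1 / 2) / ra) = ln 2 + ln (sqrt 2 - 1 / 2) - ln ra).
{ unfold Rdiv at 1; rewrite ln_mult, (ln_mult 2), ln_Rinv by first [lra | apply Rinv_0_lt_compat; lra].
  ring. }
assert (L2 : ln ((1 + rc) / (ra * ra)) = ln (1 + rc) - 2 * ln ra).
{ unfold Rdiv; rewrite ln_mult, ln_Rinv, ln_mult by first [nra | apply Rinv_0_lt_compat; nra].
  ring. }
rewrite L1, L2; replace (1 + 1) with 2 by ring; rewrite !Rmult_1_r.
rewrite Hrc at 1 3; ring_simplify; rewrite Hrc; ring.
Qed.

Lemma beta_a_eq : beta_a = 3 / 2 * qneg.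
Proof.
assert (Hc := rc_bounds); assert (Ha := ra_bounds); assert (H0 := sqrt_pos 2).
assert (Hs2 : sqrt 2 = 1 + ra) by (unfold ra; ring).
assert (Haa := ra_sqr); assert (Hrc : rc = 2 * ra) by reflexivity.
unfold beta_a, g0; change (2 * (sqrt 2 - 1)) with rc.
replace (rc * -1 + 1) with (1 - rc) by ring.
replace (1 - -1) with 2 by ring.
rewrite sqrt_1_minus_rc, qneg_alt.
replace (1 / 2 * (ra + sqrt 2)) with (sqrt 2 - 1 / 2) by (rewrite Hs2; field).
replace (sqrt rc * (ra - sqrt 2) / (rc * sqrt 2 + ra)) with (- (sqrt rc / (3 - sqrt 2))).
- rewrite atan_opp; field.
- replace (rc * sqrt 2 + ra) with (3 - sqrt 2) by (rewrite Hs2, Hrc in *; lra).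
  rewrite Hs2; field; lra.
Qed.

Lemma beta_b_eq : beta_b = qpos / ln (5 / 3).
Proof. rewrite qpos_eq; reflexivity. Qed.

Lemma beta_c_eq : beta_c = 5 / 2 * qpos.
Proof. rewrite qpos_eq; reflexivity. Qed.

(** * Numerical estimates *)

Lemma nonneg_of_derive (f f' : R -> R) :
  (forall x, 0 <= x -> is_derive f x (f' x)) -> (forall x, 0 <= x -> 0 <= f' x) ->
  f 0 = 0 -> forall x, 0 <= x -> 0 <= f x.
Proof.
intros Hd Hp H0 x Hx.
destruct (Req_dec x 0) as [-> | Hn]; [lra |].
destruct (MVT_cor2 f f' 0 x) as [c [Hc Hci]]; [lra | intros; apply is_derive_Reals, Hd; lra |].
specialize (Hp c (ltac:(lra))); nra.
Qed.

Lemma atan_upper (x : R) : 0 <= x -> atan x <= x - x ^ 3 / 3 + x ^ 5 / 5.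
Proof.
intros Hx; apply Rminus_le_0.
apply (nonneg_of_derive (fun x => x - x ^ 3 / 3 + x ^ 5 / 5 - atan x) (fun x => x ^ 6 / (1 + x ^ 2)));
  [| | rewrite atan_0; field | exact Hx]; clear x Hx; intros x Hx.
- auto_derive; [exact I | field; nra].
- apply Rmult_le_pos; [apply pow_le, Hx | apply Rlt_le, Rinv_0_lt_compat; nra].
Qed.

Lemma atan_lower (x : R) : 0 <= x -> x - x ^ 3 / 3 + x ^ 5 / 5 - x ^ 7 / 7 <= atan x.
Proof.
intros Hx; apply Rminus_le_0.
apply (nonneg_of_derive (fun x => atan x - (x - x ^ 3 / 3 + x ^ 5 / 5 - x ^ 7 / 7)) (fun x => x ^ 8 / (1 + x ^ 2)));
  [| | rewrite atan_0; field | exact Hx]; clear x Hx; intros x Hx.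
- auto_derive; [exact I | field; nra].
- apply Rmult_le_pos; [apply pow_le, Hx | apply Rlt_le, Rinv_0_lt_compat; nra].
Qed.

Lemma exp_lower (x : R) : 0 <= x ->
  1 + x + x ^ 2 / 2 + x ^ 3 / 6 + x ^ 4 / 24 + x ^ 5 / 120 <= exp x.
Proof.
intros Hx; unfold exp; destruct (exist_exp x) as [l Hl]; simpl proj1_sig.
assert (H := sum_incr _ 5 l Hl).
eapply Rle_trans; [| apply H; intros n].
- simpl; right; field.
- apply Rmult_le_pos; [apply Rlt_le, Rinv_0_lt_compat, INR_fact_lt_0 | apply pow_le, Hx].
Qed.

Lemma ln_le_of_exp (x y : R) : 0 < x -> x <= exp y -> ln x <= y.
Proof.
intros Hx H; rewrite <- (ln_exp y).
destruct (Req_dec x (exp y)) as [<- | Hn]; [lra | apply Rlt_le, ln_increasing; lra].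
Qed.

Lemma ln_le_minus_1 (x : R) : 0 < x -> ln x <= x - 1.
Proof. intros Hx; apply ln_le_of_exp; [exact Hx |]; assert (H := exp_ineq1_le (x - 1)); lra. Qed.

Lemma ln_53_bounds : 0 < ln (5 / 3) <= 5128 / 10000.
Proof.
split; [rewrite <- ln_1; apply ln_increasing; lra |].
apply ln_le_of_exp; [lra |].
eapply Rle_trans; [| apply exp_lower; lra]; lra.
Qed.

Lemma ra_bounds_fine : 41421 / 100000 < ra < 41422 / 100000.
Proof.
assert (H := sqrt_sqrt 2 (ltac:(lra))); assert (H0 := sqrt_pos 2); unfold ra; split; nra.
Qed.

Lemma sqrt_rc_bounds : 91017 / 100000 < sqrt rc < 91020 / 100000.
Proof.
assert (Ha := ra_bounds_fine); assert (Hc : rc = 2 * ra) by reflexivity.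
assert (H := sqrt_sqrt rc (ltac:(lra))); assert (H0 := sqrt_pos rc); split; nra.
Qed.

Lemma atan_le (x y : R) : x <= y -> atan x <= atan y.
Proof.
intros H; destruct (Req_dec x y) as [-> | Hn]; [lra | apply Rlt_le, atan_increasing; lra].
Qed.

Lemma qpos_alt : qpos = sqrt rc * atan (sqrt rc) - ra * ln (4 / (1 + rc)).
Proof.
assert (Hc := rc_bounds).
unfold qpos; rewrite Lam_0; unfold Lam.
assert (E : ln (4 / (1 + rc)) = 2 * ln 2 - ln (1 + rc)).
{ replace 4 with (2 * 2) by ring; unfold Rdiv.
  rewrite !ln_mult, ln_Rinv by first [lra | apply Rinv_0_lt_compat; lra]; ring. }
rewrite E, !Rmult_1_r; replace (1 + 1) with 2 by ring; unfold rc at 1; ring.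
Qed.

(** Together with [ln_53_bounds] and [qneg_upper] this is calibrated for case (b), which needs 0.552
    <= (0.345 / 0.5128) (4/3 - 0.5128); the right side is about 0.55204. *)
Lemma qpos_lower : 345 / 1000 <= qpos.
Proof.
assert (Ha := ra_bounds_fine); assert (Hc : rc = 2 * ra) by reflexivity.
assert (Hk := sqrt_rc_bounds).
rewrite qpos_alt.
assert (H1 : 738 / 1000 <= atan (sqrt rc)).
(* 3869/10000 is slightly below the tangent of half the angle [atan (sqrt rc)]; at this smaller
   argument the Taylor polynomial is accurate enough. *)
{ assert (A := atan_lower (3869 / 10000) (ltac:(lra))).
  apply Rle_trans with (2 * atan (3869 / 10000)); [lra |].
  assert (B := atan_diff (sqrt rc) (3869 / 10000) (ltac:(lra))).
  assert (C : atan (3869 / 10000) <= atan ((sqrt rc - 3869 / 10000) / (1 + sqrt rc * (3869 / 10000)))).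
  { apply atan_le; apply -> Rle_div_r; lra. }
  lra. }
assert (H2 : ln (4 / (1 + rc)) <= 7835 / 10000).
{ apply ln_le_of_exp; [apply Rdiv_lt_0_compat; lra |].
  eapply Rle_trans; [| apply exp_lower; lra].
  apply <- Rle_div_l; lra. }
nra.
Qed.

Lemma qneg_upper : qneg <= 552 / 1000.
Proof.
assert (Ha := ra_bounds_fine); assert (Hc : rc = 2 * ra) by reflexivity.
assert (Hk := sqrt_rc_bounds).
assert (Hs2 : sqrt 2 = 1 + ra) by (unfold ra; ring).
rewrite qneg_alt.
assert (H1 : atan (sqrt rc / (3 - sqrt 2)) <= 52345 / 100000).
{ eapply Rle_trans; [apply (atan_le _ (574 / 1000)); apply <- Rle_div_l; lra |].
  eapply Rle_trans; [apply atan_upper; lra | lra]. }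
assert (H2 : - ln (sqrt 2 - 1 / 2) <= 8982 / 100000).
{ rewrite <- ln_Rinv by lra; apply ln_le_of_exp; [apply Rinv_0_lt_compat; lra |].
  eapply Rle_trans; [| apply exp_lower; lra].
  rewrite <- Rdiv_1_l; apply <- Rle_div_l; lra. }
nra.
Qed.

(** In (a) the disc containing p - 1 is compared with a disc centred at 0, so its farther end
    decides. This inequality identifies that end as the one at -1. *)
Lemma qpos_le_qneg : qpos <= qneg.
Proof.
assert (Ha := ra_bounds_fine); assert (Hc : rc = 2 * ra) by reflexivity.
assert (Hk := sqrt_rc_bounds).
assert (Hs2 : sqrt 2 = 1 + ra) by (unfold ra; ring).
rewrite qpos_alt, qneg_alt.
assert (H1 : 51 / 100 <= atan (sqrt rc / (3 - sqrt 2))).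
{ eapply Rle_trans; [| apply (atan_le (5739 / 10000)); apply -> Rle_div_r; lra].
  eapply Rle_trans; [| apply atan_lower; lra]; lra. }
assert (H2 : ln (sqrt 2 - 1 / 2) <= - (85 / 1000)).
{ eapply Rle_trans; [apply ln_le_minus_1; lra | lra]. }
assert (H3 : atan (sqrt rc) <= 785 / 1000).
{ eapply Rle_trans; [apply (atan_le _ (9102 / 10000)); lra |].
  eapply Rle_trans; [apply atan_upper; lra | lra]. }
assert (H4 : 54 / 100 <= ln (4 / (1 + rc))).
{ replace (4 / (1 + rc)) with (/ ((1 + rc) / 4)) by (field; lra).
  rewrite ln_Rinv by lra.
  assert (A := ln_le_minus_1 ((1 + rc) / 4) (ltac:(lra))); lra. }
nra.
Qed.

Lemma cos_lower (y : R) : 1 - y * y / 2 <= cos y.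
Proof.
replace (cos y) with (1 - 2 * sin (y / 2) * sin (y / 2)).
- assert (H : sin (y / 2) * sin (y / 2) <= y / 2 * (y / 2)); [| lra].
  apply Rsqr_le_abs_1.
  destruct (MVT_abs sin cos 0 (y / 2)) as [c [Hc _]]; [intros; apply derivable_pt_lim_sin |].
  rewrite sin_0, !Rminus_0_r in Hc; rewrite Hc.
  assert (B := COS_bound c); assert (A : Rabs (cos c) <= 1) by (apply Rabs_le; lra).
  assert (P := Rabs_pos (y / 2)); nra.
- rewrite <- cos_2a_sin; f_equal; field.
Qed.

Lemma pos_of_derive (f f' : R -> R) (b : R) :
  (forall x, is_derive f x (f' x)) -> (forall x, 0 < x <= b -> 0 < f' x) ->
  f 0 = 0 -> forall x, 0 < x <= b -> 0 < f x.
Proof.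
intros Hd Hp H0 x Hx.
destruct (MVT_cor2 f f' 0 x) as [c [Hc Hci]]; [lra | intros; apply is_derive_Reals, Hd |].
assert (H := Rmult_lt_0_compat _ (x - 0) (Hp c (ltac:(lra))) (ltac:(lra))); lra.
Qed.

(** The inequality to which (b) reduces. The difference of the two sides and its first derivative
    vanish at 0, and its second derivative (e^d - 1)(5 - e^d)/e^d is positive for 0 < d < ln 5. The
    coefficient 4 is 3 times the diameter 4/3 allowed for the disc of log p; a larger diameter would
    make the first derivative at 0 negative. *)
Lemma exp_quadratic (d : R) : 0 < d <= 4 / 3 ->
  exp d + 5 * exp (- d) < 6 - 4 * d + 3 * (d * d).
Proof.
intros Hd.
assert (H : 0 < 6 - 4 * d + 3 * (d * d) - exp d - 5 * exp (- d)); [| lra].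
revert d Hd.
apply (pos_of_derive (fun d => 6 - 4 * d + 3 * (d * d) - exp d - 5 * exp (- d))
  (fun d => -4 + 6 * d - exp d + 5 * exp (- d))).
- intros x; auto_derive; [exact I | ring].
- apply (pos_of_derive (fun d => -4 + 6 * d - exp d + 5 * exp (- d))
    (fun d => 6 - exp d - 5 * exp (- d))).
  + intros x; auto_derive; [exact I | ring].
  + intros x Hx.
    assert (H1 : 1 < exp x) by (rewrite <- exp_0; apply exp_increasing; lra).
    assert (H5 : exp x < 5).
    { apply Rle_lt_trans with (exp (4 / 3)).
      - destruct (Req_dec x (4 / 3)) as [-> | Hn]; [lra | apply Rlt_le, exp_increasing; lra].
      - apply Rnot_le_lt; intros H5.
        (* 4/3 < ln 5 because e^4 <= 3^4 = 81 < 125 = 5^3. *)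
        assert (E : exp (4 / 3) * exp (4 / 3) * exp (4 / 3) = exp 1 * exp 1 * exp 1 * exp 1)
          by (rewrite <- !exp_plus; f_equal; field).
        assert (H3 := exp_le_3); assert (H0 := exp_pos 1).
        assert (A : 25 <= exp (4 / 3) * exp (4 / 3)) by nra.
        assert (B : exp 1 * exp 1 <= 9) by nra.
        nra. }
    rewrite exp_Ropp.
    replace (6 - exp x - 5 * / exp x) with ((exp x - 1) * (5 - exp x) / exp x) by (field; lra).
    apply Rdiv_lt_0_compat; [apply Rmult_lt_0_compat |]; lra.
  + rewrite Ropp_0, exp_0; ring.
- rewrite Ropp_0, exp_0; ring.
Qed.

(** * Exponential, logarithm and continuation along rays *)

Lemma differentiable_eq (f : R -> R -> R) (x y a b a' b' : R) :
  a = a' -> b = b' -> differentiable_pt_lim f x y a b -> differentiable_pt_lim f x y a' b'.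
Proof. intros -> -> H; exact H. Qed.

Lemma differentiable_plus (f g : R -> R -> R) (x y fx fy gx gy : R) :
  differentiable_pt_lim f x y fx fy -> differentiable_pt_lim g x y gx gy ->
  differentiable_pt_lim (fun u v => f u v + g u v) x y (fx + gx) (fy + gy).
Proof.
intros Hf Hg.
replace (fx + gx) with (1 * fx + 1 * gx) by ring.
replace (fy + gy) with (1 * fy + 1 * gy) by ring.
apply (differentiable_pt_lim_comp Rplus f g); [| assumption | assumption].
intros eps; exists eps; intros u v Hu Hv.
replace (_ - _) with 0 by ring; rewrite Rabs_R0.
apply Rmult_le_pos; [apply Rlt_le, cond_pos |].
eapply Rle_trans; [apply Rabs_pos | apply Rmax_l].
Qed.

Lemma differentiable_comp_1 (g : R -> R) (f : R -> R -> R) (x y d fx fy : R) :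
  is_derive g (f x y) d -> differentiable_pt_lim f x y fx fy ->
  differentiable_pt_lim (fun u v => g (f u v)) x y (d * fx) (d * fy).
Proof.
intros Hg Hf.
replace (d * fx) with (d * fx + 0 * fx) by ring.
replace (d * fy) with (d * fy + 0 * fy) by ring.
apply (differentiable_pt_lim_comp (fun s _ => g s) f f); [| assumption | assumption].
apply differentiable_fst, Hg.
Qed.

Lemma differentiable_cderiv (f : C -> C) (x y l1 l2 : R) :
  differentiable_pt_lim (fun u v => Re (f (u, v))) x y l1 (- l2) ->
  differentiable_pt_lim (fun u v => Im (f (u, v))) x y l2 l1 ->
  cderiv f (x, y) (l1, l2).
Proof.
intros H1 H2 eps He.
assert (He2 : 0 < eps / 2) by lra.
destruct (H1 (mkposreal _ He2)) as [d1 D1]; destruct (H2 (mkposreal _ He2)) as [d2 D2].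
simpl in D1, D2.
exists (Rmin d1 d2); split; [apply Rmin_pos; apply cond_pos |].
intros [u v] Hy.
assert (Hm := Rmax_Cmod ((u, v) - (x, y))%C).
simpl in Hm; fold (Rminus u x) (Rminus v y) in Hm.
assert (M1 := Rmax_l (Rabs (u - x)) (Rabs (v - y))).
assert (M2 := Rmax_r (Rabs (u - x)) (Rabs (v - y))).
assert (M3 := Rmin_l d1 d2); assert (M4 := Rmin_r d1 d2).
specialize (D1 u v (ltac:(lra)) (ltac:(lra))); specialize (D2 u v (ltac:(lra)) (ltac:(lra))).
eapply Rle_trans; [apply Cmod_le_sum |].
replace (fst _) with (Re (f (u, v)) - Re (f (x, y)) - (l1 * (u - x) + - l2 * (v - y)))
  by (unfold Cminus, Cplus, Copp, Cmult, Re; simpl; ring).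
replace (snd _) with (Im (f (u, v)) - Im (f (x, y)) - (l2 * (u - x) + l1 * (v - y)))
  by (unfold Cminus, Cplus, Copp, Cmult, Im; simpl; ring).
assert (M5 : eps / 2 * Rmax (Rabs (u - x)) (Rabs (v - y)) <= eps / 2 * Cmod ((u, v) - (x, y)))
  by (apply Rmult_le_compat_l; lra).
lra.
Qed.

Definition Cexp (z : C) : C := (exp (Re z) * cos (Im z), exp (Re z) * sin (Im z)).

Lemma cderiv_Cexp (z : C) : cderiv Cexp z (Cexp z).
Proof.
destruct z as [x y]; unfold Cexp at 2; simpl Re; simpl Im.
assert (He : differentiable_pt_lim (fun u _ => exp u) x y (exp x) 0)
  by apply (differentiable_fst exp), is_derive_exp.
assert (Hc := differentiable_snd cos x y _ (is_derive_cos y)).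
assert (Hs := differentiable_snd sin x y _ (is_derive_sin y)).
apply differentiable_cderiv.
- assert (H := differentiable_mult _ _ x y _ _ _ _ He Hc); simpl in H.
  revert H; apply differentiable_eq; ring.
- assert (H := differentiable_mult _ _ x y _ _ _ _ He Hs); simpl in H.
  revert H; apply differentiable_eq; ring.
Qed.

Lemma Cexp_neq0 (z : C) : Cexp z <> 0%C.
Proof.
intros E; apply (f_equal (fun v => Cmod v * Cmod v)) in E.
rewrite Cmod_sqr, Cmod_0 in E; unfold Cexp in E; simpl in E.
assert (H := exp_pos (Re z)); assert (H1 := sin2_cos2 (Im z)); unfold Rsqr in H1.
assert (exp (Re z) * exp (Re z) * (sin (Im z) * sin (Im z) + cos (Im z) * cos (Im z)) = 0) by lra.
rewrite H1 in H0; nra.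
Qed.

(* Principal logarithm on the right half-plane. *)
Definition Clog (z : C) : C :=
  (ln (Re z * Re z + Im z * Im z) / 2, atan (Im z * / Re z)).

Lemma cderiv_Clog (z : C) : 0 < Re z -> cderiv Clog z (/ z)%C.
Proof.
destruct z as [x y]; simpl; intros Hx.
assert (Hn : 0 < x * x + y * y) by nra.
assert (Dx : differentiable_pt_lim (fun u _ => u) x y 1 0)
  by apply (differentiable_fst (fun u => u)), @is_derive_id.
assert (Dy : differentiable_pt_lim (fun _ v => v) x y 0 1)
  by apply (differentiable_snd (fun u => u)), @is_derive_id.
assert (Di : differentiable_pt_lim (fun u _ => / u) x y (- 1 / (x * x)) 0)
  by (apply (differentiable_fst Rinv); auto_derive; [lra | field; lra]).
assert (D1 := differentiable_plus _ _ x y _ _ _ _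
  (differentiable_mult _ _ x y _ _ _ _ Dx Dx) (differentiable_mult _ _ x y _ _ _ _ Dy Dy)).
assert (D2 := differentiable_mult _ _ x y _ _ _ _ Dy Di).
assert (E1 := differentiable_comp_1 (fun s => ln s / 2) (fun u v => u * u + v * v) x y (/ (x * x + y * y) / 2) _ _
  (ltac:(auto_derive; [lra | field; lra])) D1).
assert (E2 := differentiable_comp_1 atan (fun u v => v * / u) x y (x * x / (x * x + y * y)) _ _
  (ltac:(auto_derive; [exact I | field; lra])) D2).
simpl in E1, E2.
apply cderiv_eq with (x / (x * x + y * y), - y / (x * x + y * y)).
{ unfold Cinv; simpl; f_equal; field; lra. }
apply differentiable_cderiv.
- revert E1; apply differentiable_eq; field; lra.
- revert E2; apply differentiable_eq; field; lra.
Qed.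

(** Modulus and real part are all that |p - 1|^2 = |p|^2 - 2 Re p + 1 requires. *)
Lemma Clog_polar (z : C) : 0 < Re z ->
  exp (Re (Clog z)) = Cmod z /\ exp (Re (Clog z)) * cos (Im (Clog z)) = Re z.
Proof.
intros Hx; assert (Hm := Cmod_sqr z).
assert (Hp : 0 < Cmod z) by (apply Cmod_pos, Cneq0_Re, Hx).
assert (E : exp (Re (Clog z)) = Cmod z).
{ unfold Clog; simpl; rewrite <- Hm, ln_mult by exact Hp.
  replace ((ln (Cmod z) + ln (Cmod z)) / 2) with (ln (Cmod z)) by field.
  apply exp_ln, Hp. }
split; [exact E | rewrite E].
unfold Clog; simpl; rewrite cos_atan; unfold Rsqr.
replace (1 + Im z * / Re z * (Im z * / Re z)) with (Rsqr (Cmod z / Re z)).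
- rewrite sqrt_Rsqr by (apply Rlt_le, Rdiv_lt_0_compat; assumption).
  field; lra.
- unfold Rsqr; replace (Cmod z / Re z * (Cmod z / Re z)) with (Cmod z * Cmod z / (Re z * Re z)) by (field; lra).
  rewrite Hm; field; lra.
Qed.

(* A first point on a ray where [Re p] fails to be positive cannot exist: before it
   [Re p > 1/3]. *)
Lemma star_bootstrap (p : C -> C) :
  (forall z, Cmod z < 1 -> ccont p z) -> p 0%C = 1%C ->
  (forall z, Cmod z < 1 -> (forall t : R, 0 <= t <= 1 -> 0 < Re (p (t * z)%C)) ->
     Cmod (p z - 1) < 2 / 3) ->
  forall z, Cmod z < 1 -> Cmod (p z - 1) < 2 / 3.
Proof.
intros Hc H0 Hb z Hz; apply Hb; [exact Hz |].
assert (Hz0 := Cmod_ge_0 z).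
set (g := fun t : R => Re (p (t * z)%C)).
assert (Htz : forall t : R, 0 <= t <= 1 -> Cmod (t * z) < 1).
{ intros t Ht; rewrite Cmod_mult, Cmod_R, Rabs_pos_eq by lra; nra. }
assert (Hg : forall t, 0 <= t <= 1 -> forall eps, 0 < eps -> exists d, 0 < d /\
  forall s, Rabs (s - t) < d -> Rabs (g s - g t) < eps).
{ intros t Ht eps He; destruct (Hc _ (Htz t Ht) eps He) as [d [Hd Hy]].
  exists d; split; [exact Hd |]; intros s Hs.
  assert (E : Cmod (s * z - t * z) < d).
  { replace (s * z - t * z)%C with (RtoC (s - t) * z)%C by (rewrite RtoC_minus; ring).
    rewrite Cmod_mult, Cmod_R; assert (A := Rabs_pos (s - t)); nra. }
  specialize (Hy _ E); unfold g.
  eapply Rle_lt_trans; [| exact Hy].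
  exact (re_le_Cmod (p (s * z)%C - p (t * z)%C)). }
set (S := fun t => 0 <= t <= 1 /\ forall s, 0 <= s <= t -> 0 < g s).
assert (Hg0 : g 0 = 1).
{ unfold g; replace (RtoC 0 * z)%C with (RtoC 0) by ring; rewrite H0; reflexivity. }
assert (HS0 : S 0).
{ split; [lra |]; intros s Hs; replace s with 0 by lra; rewrite Hg0; lra. }
destruct (completeness S) as [ts [Hub Hlub]].
{ exists 1; intros t [Ht _]; lra. }
{ exists 0; exact HS0. }
assert (Hts : 0 <= ts <= 1).
{ split; [apply Hub, HS0 | apply Hlub; intros t [Ht _]; lra]. }
assert (Hbelow : forall s, 0 <= s < ts -> 0 < g s).
{ intros s Hs; apply Rnot_le_lt; intros Hn.
  assert (ts <= s); [| lra].
  apply Hlub; intros t [Ht Hp]; apply Rnot_lt_le; intros Hst.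
  specialize (Hp s (ltac:(lra))); lra. }
assert (Hbelow2 : forall s, 0 <= s < ts -> 1 / 3 < g s).
{ intros s Hs.
  assert (A : Cmod (p (s * z)%C - 1) < 2 / 3).
  { apply Hb; [apply Htz; lra |]; intros t Ht.
    replace (t * (s * z))%C with (RtoC (t * s) * z)%C by (rewrite RtoC_mult; ring).
    apply Hbelow; nra. }
  assert (B := re_le_Cmod (p (s * z)%C - 1)).
  apply Rabs_le_between in B; unfold Cminus in A, B; rewrite re_plus, re_opp, re_RtoC in B.
  unfold g; lra. }
assert (Hgts : 0 < g ts).
{ destruct (Req_dec ts 0) as [-> | Hn]; [lra |].
  apply Rnot_le_lt; intros Hle.
  destruct (Hg ts Hts (1 / 3)) as [d [Hd Hy]]; [lra |].
  assert (M1 := Rmax_l 0 (ts - d / 2)); assert (M2 := Rmax_r 0 (ts - d / 2)).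
  assert (M3 : Rmax 0 (ts - d / 2) < ts) by (apply Rmax_lub_lt; lra).
  specialize (Hbelow2 _ (conj M1 M3)).
  assert (A := Hy (Rmax 0 (ts - d / 2)) (ltac:(apply Rabs_lt_between; lra))).
  apply Rabs_lt_between in A; lra. }
destruct (Hg ts Hts (g ts) Hgts) as [d [Hd Hy]].
(* Positivity at [ts] extends a little beyond it, so the supremum can only be stopped by the cap
   1. *)
assert (HSu : S (Rmin 1 (ts + d / 2))).
{ assert (M1 := Rmin_l 1 (ts + d / 2)); assert (M2 := Rmin_r 1 (ts + d / 2)).
  split; [split; [apply Rmin_glb; lra | lra] |].
  intros s Hs; destruct (Rlt_le_dec s ts) as [Hlt | Hge]; [apply Hbelow; lra |].
  assert (A := Hy s (ltac:(apply Rabs_lt_between; lra))).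
  apply Rabs_lt_between in A; lra. }
assert (Hle := Hub _ HSu).
assert (E1 : Rmin 1 (ts + d / 2) = 1).
{ unfold Rmin in *; destruct (Rle_dec 1 (ts + d / 2)); lra. }
rewrite E1 in HSu; apply HSu.
Qed.

Lemma in_disc_range (X Y : R) (v : C) : 0 <= X -> 0 <= Y -> in_disc X Y v ->
  - Y <= Re v <= X.
Proof.
unfold in_disc; intros HX HY H.
assert (0 <= Im v * Im v) by apply Rle_0_sqr.
split; apply Rnot_lt_le; intros Hn.
- assert (0 < (X - Re v) * (- (Re v + Y))) by (apply Rmult_lt_0_compat; lra); lra.
- assert (0 < (- (X - Re v)) * (Re v + Y)) by (apply Rmult_lt_0_compat; lra); lra.
Qed.

Lemma in_disc_scal (X Y k : R) (v : C) : 0 < k ->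
  in_disc X Y v -> in_disc (X / k) (Y / k) (v / k)%C.
Proof.
intros Hk H; unfold in_disc in *.
replace (v / k)%C with (RtoC (/ k) * v)%C by (unfold Cdiv; rewrite RtoC_inv by lra; ring).
rewrite re_scal_l, im_scal_l.
replace ((X / k - / k * Re v) * (/ k * Re v + Y / k)) with
  (/ k * / k * ((X - Re v) * (Re v + Y))) by (field; lra).
replace (/ k * Im v * (/ k * Im v)) with (/ k * / k * (Im v * Im v)) by ring.
apply Rmult_le_compat_l; [apply Rle_0_sqr | exact H].
Qed.

Lemma in_disc_Cmod_lt (X Y q : R) (v : C) : 0 <= X < q -> 0 <= Y < q -> in_disc X Y v ->
  Cmod v < q.
Proof.
intros HX HY H.
assert (Hr := in_disc_range X Y v (proj1 HX) (proj1 HY) H).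
assert (Hm := Cmod_sqr v); assert (H0 := Cmod_ge_0 v); unfold in_disc in H.
apply Rsqr_incrst_0; [unfold Rsqr | exact H0 | lra].
destruct (Rle_dec X Y); nra.
Qed.

(** * Sufficiency *)

Lemma C3_neq0 : RtoC 3 <> 0%C.
Proof. intros E; injection E; lra. Qed.

Lemma cderiv_phi_Ne (z : C) : cderiv phi_Ne z (1 - z * z)%C.
Proof.
assert (H3 := C3_neq0).
eapply (cderiv_ext_loc (fun z => 1 + z - / 3 * (z * (z * z)))%C phi_Ne z _ _ 1);
  [lra | intros y _; unfold phi_Ne; field; exact H3 | |
   apply cderiv_minus; [apply cderiv_plus; [apply cderiv_const | apply cderiv_id] |
   apply cderiv_scal; apply (cderiv_mult (fun z => z) (fun z => z * z)%C);
    [apply cderiv_id | apply (cderiv_mult (fun z => z) (fun z => z)); apply cderiv_id]]].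
field; exact H3.
Qed.

Lemma phi_Ne_analytic : analytic_on_disk phi_Ne.
Proof. apply cderiv_analytic; intros z _; eexists; apply cderiv_phi_Ne. Qed.

Lemma Cmod_sum_powers_le (a b : C) (s t : R) : Cmod a <= s -> Cmod b <= t ->
  Cmod (a * a + a * b + b * b) <= s * s + s * t + t * t.
Proof.
intros Ha Hb; assert (Ha0 := Cmod_ge_0 a); assert (Hb0 := Cmod_ge_0 b).
eapply Rle_trans; [apply Cmod_triangle |]; apply Rplus_le_compat.
- eapply Rle_trans; [apply Cmod_triangle |]; rewrite !Cmod_mult.
  apply Rplus_le_compat; apply Rmult_le_compat; assumption.
- rewrite Cmod_mult; apply Rmult_le_compat; assumption.
Qed.

(** The difference factors with cofactor 1 - (a^2 + ab + b^2)/3, of modulus at least (1 - |b|)(2 +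
    |b|)/3. This quantitative injectivity gives uniqueness of preimages and continuity of the
    inverse at once; the constant depends on [b] alone, so [a] may come near the unit circle. *)
Lemma phi_Ne_expand (a b : C) : Cmod a <= 1 -> Cmod b <= 1 ->
  Cmod (a - b) * ((1 - Cmod b) / 3) <= Cmod (phi_Ne a - phi_Ne b).
Proof.
intros Ha Hb.
assert (H3 := C3_neq0); assert (Ha0 := Cmod_ge_0 a); assert (Hb0 := Cmod_ge_0 b).
replace (phi_Ne a - phi_Ne b)%C with ((a - b) * (1 - / 3 * (a * a + a * b + b * b)))%C
  by (unfold phi_Ne; field; exact H3).
rewrite Cmod_mult; apply Rmult_le_compat_l; [apply Cmod_ge_0 |].
eapply Rle_trans; [| apply Cmod_minus_ge].
rewrite Cmod_1, Cmod_mult, Cmod_inv, Cmod_R, Rabs_pos_eq by (exact H3 || lra).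
assert (H := Cmod_sum_powers_le a b 1 (Cmod b) Ha (Rle_refl _)).
nra.
Qed.

(* [z] minimising [|T z - z|] for the contraction [T z = u + z^3/3] of a disc is a
   fixed point. *)
Lemma phi_Ne_surj (u : C) : Cmod u < 2 / 3 -> exists z, Cmod z < 1 /\ phi_Ne z = (1 + u)%C.
Proof.
intros Hu; assert (Hu0 := Cmod_ge_0 u); assert (H3 := C3_neq0).
(* The disc of radius [rho] is preserved since |u| + rho^3/3 <= |u| + 1/3, and [T] contracts it by
   the factor rho^2 <= rho. *)
set (rho := 1 / 3 + Cmod u).
assert (Hrho : 1 / 3 <= rho < 1) by (unfold rho; lra).
set (T := fun z : C => (u + / 3 * (z * (z * z)))%C).
assert (HT : forall z, Cmod z <= rho -> Cmod (T z) <= rho).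
{ intros z Hz; assert (Hz0 := Cmod_ge_0 z); unfold T.
  eapply Rle_trans; [apply Cmod_triangle |].
  rewrite !Cmod_mult, Cmod_inv, Cmod_R, Rabs_pos_eq by (exact H3 || lra).
  assert (A : Cmod z * (Cmod z * Cmod z) <= rho * (rho * rho)).
  { apply Rmult_le_compat; try nra; apply Rmult_le_compat; lra. }
  assert (B : rho * (rho * rho) <= 1) by nra.
  assert (D : rho = 1 / 3 + Cmod u) by reflexivity; lra. }
assert (Hcon : forall z y, Cmod z <= rho -> Cmod y <= rho ->
  Cmod (T z - T y) <= rho * Cmod (z - y)).
{ intros z y Hz Hy.
  replace (T z - T y)%C with ((z - y) * (/ 3 * (z * z + z * y + y * y)))%C
    by (unfold T; field; exact H3).
  rewrite !Cmod_mult, Cmod_inv, Cmod_R, Rabs_pos_eq, Rmult_comm by (exact H3 || lra).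
  apply Rmult_le_compat_r; [apply Cmod_ge_0 |].
  assert (A := Cmod_sum_powers_le z y rho rho Hz Hy); nra. }
assert (HTc : forall z, ccont (fun z => T z - z)%C z).
{ intros z; eapply cderiv_cont; apply cderiv_minus; [| apply cderiv_id].
  apply cderiv_plus; [apply cderiv_const | apply cderiv_scal].
  apply (cderiv_mult (fun z => z) (fun z => z * z)%C); [apply cderiv_id |].
  apply (cderiv_mult (fun z => z) (fun z => z)); apply cderiv_id. }
assert (HPI := PI_RGT_0).
assert (Hmp : forall r t, 0 <= r -> Cmod (polar 0 r t) = r).
{ intros r t Hr; rewrite <- (Cmod_polar 0 r t Hr) at 2; f_equal; ring. }
destruct (rect_max (fun r t => - Cmod (T (polar 0 r t) - polar 0 r t)) 0 rho 0 (2 * PI))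
  as [r [t [[Hr Ht] Hmax]]]; try lra.
{ intros r t _; apply continuity_2d_pt_opp.
  apply (Cmod_polar_continuity (fun z => T z - z)%C), HTc. }
set (z := polar 0 r t) in *.
assert (Hz : Cmod z <= rho) by (unfold z; rewrite Hmp; lra).
assert (Hfix : Cmod (T z - z) = 0).
{ assert (H0 := Cmod_ge_0 (T z - z)).
  assert (A := Hcon (T z) z (HT z Hz) Hz).
  destruct (polar_surj (T z)) as [t' [Ht' E]].
  assert (B := Hmax (Cmod (T z)) t' (conj (conj (Cmod_ge_0 _) (HT z Hz)) Ht')).
  rewrite <- E in B; nra. }
exists z; split; [lra |].
apply Cmod_eq_0 in Hfix.
unfold phi_Ne; transitivity (1 + u - (T z - z))%C; [unfold T; field; exact H3 |].
rewrite Hfix; ring.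
Qed.

(** The preimages [w z] are picked pointwise by choice. [phi_Ne_expand] makes the selection
    continuous, and [cderiv_lift] then makes it analytic, the derivative 1 - z^2 of [phi_Ne] having
    no zero in the disc. *)
Lemma subordinate_phi_Ne (p : C -> C) :
  analytic_on_disk p -> p 0%C = 1%C ->
  (forall z, Cmod z < 1 -> Cmod (p z - 1) < 2 / 3) ->
  subordinate p phi_Ne.
Proof.
intros Hp H0 Hb; split; [exact Hp | split; [exact phi_Ne_analytic |]].
assert (Hsol : forall z, exists y, Cmod z < 1 -> Cmod y < 1 /\ phi_Ne y = p z).
{ intros z; destruct (Rlt_dec (Cmod z) 1) as [Hz | Hz].
  - destruct (phi_Ne_surj _ (Hb z Hz)) as [y [Hy E]]; exists y; intros _; split; [exact Hy |].
    rewrite E; ring.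
  - exists 0%C; intros; contradiction. }
set (w := fun z => proj1_sig (constructive_indefinite_description _ (Hsol z))).
assert (Hw : forall z, Cmod z < 1 -> Cmod (w z) < 1 /\ phi_Ne (w z) = p z).
{ intros z; unfold w; destruct constructive_indefinite_description; assumption. }
assert (Hinj : forall y z, Cmod y < 1 -> Cmod z < 1 ->
  Cmod (w y - w z) * ((1 - Cmod (w z)) / 3) <= Cmod (p y - p z)).
{ intros y z Hy Hz; destruct (Hw y Hy) as [Hy1 <-]; destruct (Hw z Hz) as [Hz1 <-].
  apply phi_Ne_expand; lra. }
exists w; repeat split.
- apply cderiv_analytic; intros z Hz; destruct (Hw z Hz) as [Hz1 Hz2].
  eexists; apply cderiv_lift with (g := phi_Ne) (h := p) (r := 1 - Cmod z).
  + lra.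
  + intros y Hy; apply Hw; assert (A := Cmod_minus_ge y z); lra.
  + intros eps He.
    assert (Hk : 0 < eps * ((1 - Cmod (w z)) / 3)) by (apply Rmult_lt_0_compat; lra).
    destruct (cderiv_cont _ _ _ (analytic_cderiv p Hp z Hz) _ Hk) as [d [Hd Hy]].
    exists (Rmin d (1 - Cmod z)); split; [apply Rmin_pos; lra |].
    intros y Hyd.
    specialize (Hy y (Rlt_le_trans _ _ _ Hyd (Rmin_l _ _))).
    assert (A := Rlt_le_trans _ _ _ Hyd (Rmin_r _ _)).
    assert (B := Cmod_minus_ge y z).
    assert (D := Hinj y z (ltac:(lra)) Hz).
    apply Rmult_lt_reg_r with ((1 - Cmod (w z)) / 3); lra.
  + apply cderiv_phi_Ne.
  + apply Cneq0_Cmod; eapply Rlt_le_trans; [| apply Cmod_minus_ge].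
    rewrite Cmod_1, Cmod_mult; assert (A := Cmod_ge_0 (w z)); nra.
  + apply (analytic_cderiv p Hp z Hz).
- assert (H01 : Cmod 0 < 1) by (rewrite Cmod_0; lra).
  destruct (Hw 0%C H01) as [Hz1 Hz2].
  assert (A := phi_Ne_expand 0 (w 0%C) (ltac:(lra)) (ltac:(lra))).
  rewrite Hz2, H0 in A.
  replace (phi_Ne 0 - 1)%C with (RtoC 0) in A by (unfold phi_Ne; field; apply C3_neq0).
  rewrite Cmod_0 in A.
  replace (0 - w 0)%C with (- w 0%C)%C in A by ring; rewrite Cmod_opp in A.
  apply Cmod_eq_0; assert (B := Cmod_ge_0 (w 0%C)).
  nra.
- intros z Hz; apply Hw, Hz.
- intros z Hz; symmetry; apply Hw, Hz.
Qed.

Lemma subordinate_phi_RL (f : C -> C) : subordinate f phi_RL ->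
  exists w : C -> C, (forall z, Cmod z < 1 -> Cmod (w z) <= Cmod z) /\
    forall z, Cmod z < 1 -> (f z - 1)%C = (ra * (1 - sq (w z)))%C.
Proof.
intros [_ [_ [w [Hw [Hw0 [Hw1 Hf]]]]]]; exists w; split.
- apply schwarz; try assumption.
  intros z Hz; exists (C_derive w z); apply analytic_cderiv; assumption.
- intros z Hz; rewrite (Hf z Hz), phi_RL_sq; ring.
Qed.

Lemma qpos_pos : 0 < qpos.
Proof. assert (H := qpos_lower); lra. Qed.

(** The common core of the three cases, which differ only in V. The upper bounds are strict because
    [Lam] is strictly decreasing and |z| < 1, so the end points of the diameter are never
    reached. *)
Lemma radial_disc (V w : C -> C) (beta : R) (z : C) :
  0 < beta -> Cmod z < 1 ->
  (forall y, Cmod y < 1 -> Cmod (w y) <= Cmod y) ->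
  V 0%C = 0%C ->
  (forall t : R, 0 <= t <= 1 -> exists l, cderiv V (t * z)%C l /\
     (beta * (t * z * l))%C = (ra * (1 - sq (w (t * z))))%C) ->
  exists X Y, 0 <= X < qpos / beta /\ 0 <= Y < qneg / beta /\ in_disc X Y (V z).
Proof.
intros Hb Hz Hw H0 HV.
assert (Hz0 := Cmod_ge_0 z).
assert (HX := Qr_range_pos (Cmod z) (conj Hz0 Hz)).
assert (HY := Qr_range_neg (Cmod z) (conj Hz0 Hz)).
assert (Hd : in_disc (Qr (Cmod z)) (- Qr (- Cmod z)) (beta * V z)%C).
{ apply (ray_disc (fun z => beta * V z)%C w z Hz Hw).
  - rewrite H0; ring.
  - intros t Ht; destruct (HV t Ht) as [l [Hl E]].
    exists (beta * l)%C; split; [apply cderiv_scal, Hl | rewrite <- E; ring]. }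
assert (Hi : 0 < / beta) by (apply Rinv_0_lt_compat, Hb).
exists (Qr (Cmod z) / beta), (- Qr (- Cmod z) / beta); repeat split.
- apply Rmult_le_pos; lra.
- apply Rmult_lt_compat_r; lra.
- apply Rmult_le_pos; lra.
- apply Rmult_lt_compat_r; lra.
- apply (in_disc_scal _ _ beta) in Hd; [| exact Hb].
  replace (beta * V z / beta)%C with (V z) in Hd; [exact Hd |].
  field; intros E; injection E; lra.
Qed.

Lemma ray_in_disk (z : C) (t : R) : Cmod z < 1 -> 0 <= t <= 1 -> Cmod (t * z) < 1.
Proof.
intros Hz Ht; assert (H0 := Cmod_ge_0 z).
rewrite Cmod_mult, Cmod_R, Rabs_pos_eq by lra; nra.
Qed.

Lemma sufficient_a : sufficient_from lhs_a beta_a.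
Proof.
intros beta p Hbeta Hp H0 Hsub.
rewrite beta_a_eq in Hbeta.
assert (Hq := qpos_pos); assert (Hpn := qpos_le_qneg).
destruct (subordinate_phi_RL _ Hsub) as [w [Hw Hf]].
apply subordinate_phi_Ne; [exact Hp | exact H0 |]; intros z Hz.
destruct (radial_disc (fun z => p z - 1)%C w beta z) as [X [Y [HX [HY Hd]]]];
  [lra | exact Hz | exact Hw | rewrite H0; ring | |].
- intros t Ht; assert (Htz := ray_in_disk z t Hz Ht).
  exists (C_derive p (t * z)%C); split.
  + apply cderiv_eq with (C_derive p (t * z)%C - 0)%C; [ring |].
    apply cderiv_minus; [apply analytic_cderiv; assumption | apply cderiv_const].
  + rewrite <- (Hf _ Htz); unfold lhs_a; ring.
- assert (Hqb : qneg / beta <= 2 / 3) by (apply <- Rle_div_l; lra).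
  assert (Hqp : qpos / beta <= qneg / beta).
  { apply Rmult_le_compat_r; [apply Rlt_le, Rinv_0_lt_compat; lra | exact Hpn]. }
  apply (in_disc_Cmod_lt X Y); [lra | lra | exact Hd].
Qed.

(** The left side is |e^v - 1|^2. Put Re v = ln(5/3) - d; then (Im v)^2 <= d (4/3 - d), and division
    by (5/9) e^(-d) turns the claim into e^d + 5 e^(-d) < 6 cos(Im v). With cos y >= 1 - y^2/2 this
    follows from [exp_quadratic]. *)
Lemma log_disc_bound (X Y : R) (v : C) :
  0 <= X < ln (5 / 3) -> 0 <= Y <= 4 / 3 - ln (5 / 3) -> in_disc X Y v ->
  exp (Re v) * exp (Re v) - 2 * (exp (Re v) * cos (Im v)) + 1 < 4 / 9.
Proof.
intros HX HY Hd.
assert (Hr := in_disc_range X Y v (proj1 HX) (proj1 HY) Hd); unfold in_disc in Hd.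
set (x := Re v) in *; set (y := Im v) in *.
set (d := ln (5 / 3) - x).
assert (Hy : y * y <= d * (4 / 3 - d)).
{ eapply Rle_trans; [exact Hd |]; unfold d; apply Rmult_le_compat; lra. }
assert (Hc := cos_lower y).
assert (He := exp_quadratic d (ltac:(unfold d; lra))).
assert (Hex : exp x = 5 / 3 * exp (- d)).
{ unfold d; replace (- (ln (5 / 3) - x)) with (x + - ln (5 / 3)) by ring.
  rewrite exp_plus, exp_Ropp, exp_ln by lra; field. }
assert (Hed : exp d = / exp (- d)) by (rewrite exp_Ropp, Rinv_inv; reflexivity).
assert (Hp := exp_pos (- d)); rewrite Hed in He; rewrite Hex.
set (e := exp (- d)) in *.
assert (Hi : e * / e = 1) by (field; lra).
assert (Hm : e * (/ e + 5 * e) < e * (6 * cos y)) by (apply Rmult_lt_compat_l; lra).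
lra.
Qed.

Lemma sufficient_b : sufficient_from lhs_b beta_b.
Proof.
intros beta p Hbeta Hp H0 Hsub.
rewrite beta_b_eq in Hbeta.
assert (Hq := qpos_lower); assert (Hqn := qneg_upper).
assert (Hln := ln_53_bounds).
assert (Hb0 : 0 < beta) by (eapply Rlt_le_trans; [| exact Hbeta]; apply Rdiv_lt_0_compat; lra).
assert (Hqb : qpos <= beta * ln (5 / 3)) by (apply Rle_div_l; lra).
destruct (subordinate_phi_RL _ Hsub) as [w [Hw Hf]].
apply subordinate_phi_Ne; [exact Hp | exact H0 |]; apply star_bootstrap.
{ intros z Hz; eapply cderiv_cont, analytic_cderiv; assumption. }
{ exact H0. }
intros z Hz Hpos.
destruct (radial_disc (fun z => Clog (p z)) w beta z) as [X [Y [HX [HY Hd]]]];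
  [exact Hb0 | exact Hz | exact Hw | | |].
- rewrite H0; unfold Clog; simpl.
  replace (1 * 1 + 0 * 0) with 1 by ring; rewrite ln_1, Rmult_0_l, atan_0.
  unfold RtoC; f_equal; field.
- intros t Ht; assert (Htz := ray_in_disk z t Hz Ht).
  assert (Hn := Cneq0_Re _ (Hpos t Ht)).
  eexists; split.
  + apply (cderiv_comp Clog p); [apply cderiv_Clog, Hpos, Ht | apply analytic_cderiv; assumption].
  + rewrite <- (Hf _ Htz); unfold lhs_b; field; exact Hn.
- assert (HXl : qpos / beta <= ln (5 / 3)) by (apply <- Rle_div_l; lra).
  assert (HYl : qneg / beta <= 4 / 3 - ln (5 / 3)).
  { apply <- Rle_div_l; [| lra].
    assert (A : beta * ln (5 / 3) <= beta * (5128 / 10000)) by (apply Rmult_le_compat_l; lra).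
    lra. }
  assert (HB := log_disc_bound X Y _ (ltac:(lra)) (ltac:(lra)) Hd); cbv beta in HB.
  assert (Hpz : 0 < Re (p z)).
  { assert (A := Hpos 1 (ltac:(lra))); rewrite Cmult_1_l in A; exact A. }
  destruct (Clog_polar _ Hpz) as [E1 E2]; rewrite E2, E1 in HB.
  apply Rsqr_incrst_0; [unfold Rsqr | apply Cmod_ge_0 | lra].
  assert (E3 := Cmod_sqr (p z)); rewrite Cmod_sqr.
  unfold Cminus; rewrite re_plus, re_opp, im_plus, im_opp, re_RtoC, im_RtoC; lra.
Qed.

Lemma sufficient_c : sufficient_from lhs_c beta_c.
Proof.
intros beta p Hbeta Hp H0 Hsub.
rewrite beta_c_eq in Hbeta.
assert (Hq := qpos_lower); assert (Hqn := qneg_upper).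
destruct (subordinate_phi_RL _ Hsub) as [w [Hw Hf]].
apply subordinate_phi_Ne; [exact Hp | exact H0 |]; apply star_bootstrap.
{ intros z Hz; eapply cderiv_cont, analytic_cderiv; assumption. }
{ exact H0. }
intros z Hz Hpos.
destruct (radial_disc (fun z => 1 - / p z)%C w beta z) as [X [Y [HX [HY Hd]]]];
  [lra | exact Hz | exact Hw | rewrite H0; field; exact C1_nz | |].
- intros t Ht; assert (Htz := ray_in_disk z t Hz Ht).
  assert (Hn := Cneq0_Re _ (Hpos t Ht)).
  eexists; split.
  + apply cderiv_minus; [apply cderiv_const |].
    apply cderiv_inv; [exact Hn | apply analytic_cderiv; assumption].
  + rewrite <- (Hf _ Htz); unfold lhs_c; field; exact Hn.
- assert (Hpz : 0 < Re (p z)).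
  { assert (A := Hpos 1 (ltac:(lra))); rewrite Cmult_1_l in A; exact A. }
  assert (Hn := Cneq0_Re _ Hpz).
  assert (HXl : qpos / beta <= 2 / 5) by (apply <- Rle_div_l; lra).
  assert (HYl : qneg / beta <= 1) by (apply <- Rle_div_l; lra).
  assert (Hr := in_disc_range X Y _ (proj1 HX) (proj1 HY) Hd); unfold in_disc in Hd.
  set (u := (1 - / p z)%C) in *.
  assert (E1 : (p z - 1)%C = (p z * u)%C) by (unfold u; field; exact Hn).
  assert (E2 : (p z * (1 - u))%C = 1%C) by (unfold u; field; exact Hn).
  apply (f_equal Cmod) in E2; rewrite Cmod_mult, Cmod_1 in E2.
  rewrite E1, Cmod_mult.
  assert (Hpm := Cmod_pos _ Hn).
  (* Since |p| |1 - u| = 1 and p - 1 = p u, the claim |p - 1| < 2/3 becomes an Apollonius disc for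
     u, with diameter [-2, 2/5]. *)
  assert (Hlt : Cmod u < 2 / 3 * Cmod (1 - u)).
  { apply Rsqr_incrst_0; [unfold Rsqr | apply Cmod_ge_0 | assert (A := Cmod_ge_0 (1 - u)); lra].
    replace (2 / 3 * Cmod (1 - u) * (2 / 3 * Cmod (1 - u))) with
      (4 / 9 * (Cmod (1 - u) * Cmod (1 - u))) by field.
    rewrite !Cmod_sqr; unfold Cminus.
    rewrite re_plus, re_opp, im_plus, im_opp, re_RtoC, im_RtoC.
    set (x := Re u) in *; set (y := Im u) in *.
    (* The squares of x cancel, leaving an affine function of x. Its slope 5X - 5Y + 8 is positive
       as Y < 1, and its value at x = X is (5X - 2)(X + 2) < 0. *)
    assert (A : 5 * ((X - x) * (x + Y)) + 5 * (x * x) + 8 * x - 4 < 0); [| lra].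
    nra. }
  apply (Rmult_lt_compat_l (Cmod (p z))) in Hlt; [| exact Hpm]; lra.
Qed.

(** * Sharpness *)

(* [atan u] is written with the logarithms of [u - i] and [u + i], which stay in the
   right half-plane when [0 < Re u]. *)
Definition CLam (s : C) : C :=
  (rc * Clog (1 + s) - ra * Clog (1 + rc * (s * s))
   - sqrt rc * (PI / 2 + / (2 * Ci) * (Clog (sqrt rc * s - Ci) - Clog (sqrt rc * s + Ci))))%C.

Lemma C2_neq0 : RtoC 2 <> 0%C.
Proof. intros E; injection E; lra. Qed.

Lemma sqrt_rc_pos : 0 < sqrt rc.
Proof. apply sqrt_lt_R0; assert (H := rc_bounds); lra. Qed.

(** The two positivity conditions keep all four logarithms in the right half-plane. They hold for s
    = [sq z], whose square is [sq_arg z]. *)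
Lemma cderiv_CLam (s : C) : 0 < Re s -> 0 < Re (s * s)%C ->
  cderiv CLam s (- (rc * (1 + rc) * s / ((1 + s) * (1 + rc * (s * s)))))%C.
Proof.
intros Hs Hss; assert (Hc := rc_bounds); assert (Hk := sqrt_rc_pos).
assert (P1 : 0 < Re (1 + s)%C) by (rewrite re_plus; simpl; lra).
assert (P2 : 0 < Re (1 + rc * (s * s))%C) by (rewrite re_plus, re_scal_l; simpl Re at 1; nra).
assert (P3 : 0 < Re (sqrt rc * s - Ci)%C).
{ unfold Cminus; rewrite re_plus, re_opp, re_scal_l; simpl Re at 2; nra. }
assert (P4 : 0 < Re (sqrt rc * s + Ci)%C).
{ rewrite re_plus, re_scal_l; simpl Re at 2; nra. }
assert (Hk2 : (sqrt rc * sqrt rc)%C = RtoC rc) by (rewrite <- RtoC_mult, sqrt_sqrt by lra; reflexivity).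
assert (Hi : (Ci * Ci)%C = (- (1))%C) by (unfold Ci, Cmult, Copp, RtoC; simpl; f_equal; ring).
assert (Hra : RtoC ra = (rc / 2)%C) by (unfold rc; rewrite RtoC_mult; field; exact C2_neq0).
eapply cderiv_eq; [|
  apply cderiv_minus; [apply cderiv_minus |]; apply cderiv_scal;
  [ apply (cderiv_comp Clog (fun s => 1 + s)%C); [apply cderiv_Clog, P1 |];
    apply cderiv_plus; [apply cderiv_const | apply cderiv_id]
  | apply (cderiv_comp Clog (fun s => 1 + rc * (s * s))%C); [apply cderiv_Clog, P2 |];
    apply cderiv_plus; [apply cderiv_const | apply cderiv_scal];
    apply (cderiv_mult (fun s => s) (fun s => s)); apply cderiv_id
  | apply cderiv_plus; [apply cderiv_const | apply cderiv_scal, cderiv_minus];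
    [ apply (cderiv_comp Clog (fun s => sqrt rc * s - Ci)%C); [apply cderiv_Clog, P3 |];
      apply cderiv_minus; [apply cderiv_scal, cderiv_id | apply cderiv_const]
    | apply (cderiv_comp Clog (fun s => sqrt rc * s + Ci)%C); [apply cderiv_Clog, P4 |];
      apply cderiv_plus; [apply cderiv_scal, cderiv_id | apply cderiv_const] ] ] ].
cbv beta.
apply Cneq0_Re in P1; apply Cneq0_Re in P2; apply Cneq0_Re in P3; apply Cneq0_Re in P4.
assert (H2 := C2_neq0); assert (Hci := Ci_nz).
assert (E34 : ((sqrt rc * s - Ci) * (sqrt rc * s + Ci))%C = (1 + rc * (s * s))%C).
{ rewrite <- Hk2; transitivity (sqrt rc * sqrt rc * (s * s) - Ci * Ci)%C; [ring | rewrite Hi; ring]. }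
assert (E : (sqrt rc * (0 + / (2 * Ci) * (/ (sqrt rc * s - Ci) * (sqrt rc * 1 - 0) -
   / (sqrt rc * s + Ci) * (sqrt rc * 1 + 0))))%C = (rc / (1 + rc * (s * s)))%C).
{ rewrite <- E34, <- Hk2; field; repeat split; assumption. }
rewrite E, Hra; field; repeat split; assumption.
Qed.

Lemma Clog_real (x : R) : Clog x = RtoC (ln (x * x) / 2).
Proof.
unfold Clog, RtoC; simpl; f_equal; [do 2 f_equal; ring |].
rewrite Rmult_0_l, atan_0; reflexivity.
Qed.

Lemma CLam_real (s : R) : 0 < s -> CLam s = RtoC (Lam s).
Proof.
intros Hs; assert (Hc := rc_bounds); assert (Hk := sqrt_rc_pos).
assert (Hks : 0 < sqrt rc * s) by (apply Rmult_lt_0_compat; assumption).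
assert (L : forall x, 0 < x -> Clog x = RtoC (ln x)).
{ intros x Hx; rewrite Clog_real, ln_mult by exact Hx; f_equal; field. }
unfold CLam, Lam.
rewrite <- !RtoC_mult, <- !RtoC_plus, !L by nra.
(* For real u > 0 the difference of logarithms is -2i atan(1/u), and atan(1/u) = pi/2 - atan u
   explains the summand pi/2 in [CLam]. *)
replace (Clog (RtoC (sqrt rc * s) - Ci) - Clog (RtoC (sqrt rc * s) + Ci))%C
  with (- (2 * Ci) * RtoC (atan (/ (sqrt rc * s))))%C.
- replace (/ (2 * Ci) * (- (2 * Ci) * RtoC (atan (/ (sqrt rc * s)))))%C
    with (- RtoC (atan (/ (sqrt rc * s))))%C by (field; repeat split; first [exact Ci_nz | exact C2_neq0]).
  rewrite atan_inv by exact Hks.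
  rewrite <- RtoC_div, <- RtoC_opp, <- RtoC_plus, <- !RtoC_mult, <- !RtoC_minus by lra.
  f_equal; ring.
- unfold Clog, Ci, Cminus, Cplus, Cmult, Copp, RtoC, Re, Im; simpl.
  replace ((0 + - (1)) * / (sqrt rc * s + - 0)) with (- / (sqrt rc * s)) by (field; lra).
  replace ((0 + 1) * / (sqrt rc * s + 0)) with (/ (sqrt rc * s)) by (field; lra).
  rewrite atan_opp; f_equal; [| ring].
  replace ((sqrt rc * s + - 0) * (sqrt rc * s + - 0) + (0 + - (1)) * (0 + - (1)))
    with ((sqrt rc * s + 0) * (sqrt rc * s + 0) + (0 + 1) * (0 + 1)) by ring.
  ring.
Qed.

Lemma Csqrt_real (x : R) : 0 <= x -> Csqrt x = RtoC (sqrt x).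
Proof.
intros Hx; unfold Csqrt; rewrite Cmod_R, Rabs_pos_eq by exact Hx; simpl.
destruct Rlt_dec as [H | _]; [lra |].
replace ((x + x) / 2) with x by field; replace ((x - x) / 2) with 0 by field.
rewrite sqrt_0; reflexivity.
Qed.

Lemma sq_real (x : R) : -1 < x < 1 -> sq x = RtoC (rsq x).
Proof.
intros Hx; assert (Hc := rc_bounds); assert (Hd : 0 < 1 + rc * x) by nra.
unfold sq, sq_arg, rsq.
rewrite <- RtoC_mult, <- RtoC_plus, <- RtoC_minus, <- RtoC_div by lra.
apply Csqrt_real, Rlt_le, Rdiv_lt_0_compat; lra.
Qed.

Definition CQ (z : C) : C := (CLam (sq z) - CLam 1)%C.

Lemma CQ_real (x : R) : -1 < x < 1 -> CQ x = RtoC (Qr x).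
Proof.
intros Hx; unfold CQ, Qr.
rewrite sq_real, !CLam_real, RtoC_minus by first [exact Hx | lra | apply rsq_pos; lra].
reflexivity.
Qed.

Lemma CQ_0 : CQ 0 = 0%C.
Proof. rewrite CQ_real, Qr_0 by lra; reflexivity. Qed.

Lemma cderiv_CQ (z : C) : Cmod z < 1 ->
  exists l, cderiv CQ z l /\ (z * l)%C = (ra * (1 - sq z))%C.
Proof.
intros Hz; assert (Hc := rc_bounds).
assert (Hs := sq_Re_pos z Hz).
assert (Hss : (sq z * sq z)%C = sq_arg z) by apply Csqrt_sqr.
assert (Hv := sq_arg_pos z Hz).
assert (P1 : 0 < Re (1 + sq z)%C) by (rewrite re_plus, re_RtoC; lra).
assert (P2 : 0 < Re (1 + rc * (sq z * sq z))%C)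
  by (rewrite re_plus, re_scal_l, re_RtoC, Hss; apply Rplus_lt_0_compat, Rmult_lt_0_compat; lra).
assert (Hd := sq_den_neq0 z Hz).
assert (Hinv := sq_arg_inv z Hz).
assert (ED : ((1 + rc * z) * (1 + rc * (sq z * sq z)))%C = (1 + rc)%C).
{ rewrite Hss; unfold sq_arg; field; exact Hd. }
rewrite <- Hss in Hinv.
eexists; split.
- apply cderiv_minus; [| apply cderiv_const].
  apply (cderiv_comp CLam sq); [apply cderiv_CLam; [exact Hs | rewrite Hss; exact Hv] |].
  apply cderiv_sq, Hz.
- apply Cneq0_Re in P1; apply Cneq0_Re in P2; apply Cneq0_Re in Hs.
  rewrite <- ED; unfold rc at 1; rewrite RtoC_mult.
  transitivity (ra * (z * (1 + rc * (sq z * sq z))) / (1 + sq z))%C.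
  + field; repeat split; first [assumption | exact C2_neq0].
  + rewrite <- Hinv; field; exact P1.
Qed.

Lemma subordinate_phi_RL_self (f : C -> C) :
  (forall z, Cmod z < 1 -> f z = phi_RL z) -> subordinate f phi_RL.
Proof.
intros Hf; split; [| split; [exact phi_RL_analytic |]].
- apply cderiv_analytic; intros z Hz; eexists.
  eapply (cderiv_ext_loc phi_RL f z _ _ (1 - Cmod z));
    [lra | | reflexivity | apply (analytic_cderiv _ phi_RL_analytic z Hz)].
  intros y Hy; symmetry; apply Hf; assert (A := Cmod_minus_ge y z); lra.
- exists (fun z => z); repeat split; try assumption.
  + apply cderiv_analytic; intros z _; eexists; apply cderiv_id.
  + intros z Hz; exact Hz.
Qed.

Lemma phi_Ne_real_range (w : C) (y : R) : Cmod w < 1 -> phi_Ne w = RtoC y -> 1 / 3 < y < 5 / 3.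
Proof.
intros Hw E; assert (Hm := Cmod_sqr w); assert (H0 := Cmod_ge_0 w).
replace (phi_Ne w) with (1 + w - RtoC (/ 3) * (w * (w * w)))%C in E.
2:{ unfold phi_Ne; rewrite RtoC_inv by lra; field; exact C3_neq0. }
destruct w as [a b]; unfold RtoC, Cminus, Cplus, Copp, Cmult in E; simpl in E, Hm.
injection E; intros E2 E1; clear E.
assert (Hab : a * a + b * b < 1) by nra.
(* A real value forces a real argument: the imaginary part is b (1 - a^2 + b^2/3), whose second
   factor is positive in the disc. *)
assert (Hb : b = 0).
{ assert (F : b * (1 - a * a + b * b / 3) = 0) by lra.
  apply Rmult_integral in F; destruct F as [F | F]; [exact F | nra]. }
subst b; assert (Ha : -1 < a < 1) by nra.
assert (E3 : y = 1 + a - a * (a * a) / 3) by lra.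
(* The two products equal 3 (5/3 - y) and 3 (y - 1/3). *)
assert (0 < (1 - a) * (1 - a) * (2 + a)) by (repeat apply Rmult_lt_0_compat; lra).
assert (0 < (1 + a) * (1 + a) * (2 - a)) by (repeat apply Rmult_lt_0_compat; lra).
lra.
Qed.

Lemma not_subordinate_phi_Ne (p : C -> C) (x y : R) :
  -1 < x < 1 -> p x = RtoC y -> y <= 1 / 3 \/ 5 / 3 <= y -> ~ subordinate p phi_Ne.
Proof.
intros Hx Hp Hy [_ [_ [w [_ [_ [Hw Hf]]]]]].
assert (Hxd : Cmod x < 1) by (rewrite Cmod_R; apply Rabs_lt_between; lra).
assert (A := phi_Ne_real_range (w x) y (Hw x Hxd)).
rewrite <- (Hf x Hxd) in A; specialize (A Hp); lra.
Qed.

(** The extremal values sit at the end points, where [rsq] need not be differentiable (it has a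
    square-root singularity at 1). Continuity is enough to approach them from inside the disc. *)
Lemma Qr_continuous (x : R) : -1 <= x <= 1 -> continuous Qr x.
Proof.
intros Hx; assert (Hc := rc_bounds).
apply (continuous_minus (fun x => Lam (rsq x)) (fun _ => Lam 1)); [| apply continuous_const].
apply (continuous_comp rsq Lam).
- apply (continuous_comp (fun x => (1 - x) / (1 + rc * x)) sqrt); [| apply continuous_sqrt].
  apply @ex_derive_continuous; auto_derive; nra.
- apply @ex_derive_continuous; eexists; apply Lam_derive, sqrt_pos.
Qed.

Lemma Qr_near_1 (m : R) : m < qpos -> exists x, 0 < x < 1 /\ m < Qr x.
Proof.
intros Hm.
assert (E : Qr 1 = qpos).
{ unfold Qr, qpos, rsq; replace ((1 - 1) / _) with 0 by (unfold Rdiv; ring); rewrite sqrt_0; reflexivity. }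
assert (H := Qr_continuous 1 (ltac:(lra))).
assert (He : 0 < qpos - m) by lra.
destruct (proj1 (filterlim_locally _ _) H (mkposreal _ He)) as [d Hd].
assert (M1 := Rmin_l 1 d); assert (M2 := Rmin_r 1 d).
assert (M3 := Rmin_pos 1 d Rlt_0_1 (cond_pos d)).
exists (1 - Rmin 1 d / 2); split; [lra |].
assert (A := Hd (1 - Rmin 1 d / 2)).
change (Rabs (1 - Rmin 1 d / 2 - 1) < d ->
  Rabs (Qr (1 - Rmin 1 d / 2) - Qr 1) < qpos - m) in A.
rewrite E in A.
specialize (A (ltac:(apply Rabs_lt_between; lra))); apply Rabs_lt_between in A; lra.
Qed.

Lemma Qr_near_m1 (m : R) : m < qneg -> exists x, -1 < x < 0 /\ m < - Qr x.
Proof.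
intros Hm.
assert (E : Qr (-1) = - qneg) by (unfold Qr, qneg; rewrite rsq_m1; ring).
assert (H := Qr_continuous (-1) (ltac:(lra))).
assert (He : 0 < qneg - m) by lra.
destruct (proj1 (filterlim_locally _ _) H (mkposreal _ He)) as [d Hd].
assert (M1 := Rmin_l 1 d); assert (M2 := Rmin_r 1 d).
assert (M3 := Rmin_pos 1 d Rlt_0_1 (cond_pos d)).
exists (-1 + Rmin 1 d / 2); split; [lra |].
assert (A := Hd (-1 + Rmin 1 d / 2)).
change (Rabs (-1 + Rmin 1 d / 2 - -1) < d ->
  Rabs (Qr (-1 + Rmin 1 d / 2) - Qr (-1)) < qneg - m) in A.
rewrite E in A.
specialize (A (ltac:(apply Rabs_lt_between; lra))); apply Rabs_lt_between in A; lra.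
Qed.

(** [P beta] solves the hypothesis with equality, the Schwarz function being the identity. As [b]
    may be negative or small, the failure is exhibited at the larger of [b] and [beta0 / 2]: this
    keeps the divisor [beta] positive and, in (c), [qpos / beta] below 1. *)
Lemma not_sufficient (lhs : R -> (C -> C) -> C -> C) (P : R -> C -> C) (beta0 b : R) :
  0 < beta0 -> b < beta0 ->
  (forall beta, beta0 / 2 <= beta < beta0 ->
     (forall z, Cmod z < 1 -> exists l, cderiv (P beta) z l /\ lhs beta (P beta) z = phi_RL z) /\
     P beta 0%C = 1%C /\ ~ subordinate (P beta) phi_Ne) ->
  ~ sufficient_from lhs b.
Proof.
intros H0 Hb HP Hsuf.
destruct (HP (Rmax b (beta0 / 2))) as [H1 [H2 H3]];
  [split; [apply Rmax_r | apply Rmax_lub_lt; lra] |].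
apply H3, (Hsuf (Rmax b (beta0 / 2))); [apply Rmax_l | | exact H2 |].
- apply cderiv_analytic; intros z Hz; destruct (H1 z Hz) as [l [Hl _]]; exists l; exact Hl.
- apply subordinate_phi_RL_self; intros z Hz; destruct (H1 z Hz) as [_ [_ E]]; exact E.
Qed.

Lemma RtoC_neq0 (x : R) : x <> 0 -> RtoC x <> 0%C.
Proof. intros H E; apply H; injection E; trivial. Qed.

Lemma cderiv_CQ_div (beta : R) (z : C) : beta <> 0 -> Cmod z < 1 ->
  exists l, cderiv (fun z => CQ z / beta)%C z l /\ (beta * (z * l))%C = (ra * (1 - sq z))%C.
Proof.
intros Hb Hz; destruct (cderiv_CQ z Hz) as [l [Hl E]].
exists (/ beta * l)%C; split.
- eapply (cderiv_ext_loc (fun z => / beta * CQ z)%C _ z _ _ 1);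
    [lra | intros y _; unfold Cdiv; apply Cmult_comm | reflexivity | apply cderiv_scal, Hl].
- rewrite <- E; field; apply RtoC_neq0, Hb.
Qed.

Lemma sharp_a (b : R) : b < beta_a -> ~ sufficient_from lhs_a b.
Proof.
rewrite beta_a_eq; intros Hb.
assert (Hq := qpos_pos); assert (Hpn := qpos_le_qneg).
apply not_sufficient with (fun beta z => 1 + CQ z / beta)%C (3 / 2 * qneg); [lra | exact Hb |].
intros beta Hbeta; repeat split.
- intros z Hz; destruct (cderiv_CQ_div beta z (ltac:(lra)) Hz) as [l [Hl E]].
  assert (Hd : cderiv (fun z => 1 + CQ z / beta)%C z (0 + l)%C)
    by (apply cderiv_plus; [apply cderiv_const | exact Hl]).
  eexists; split; [exact Hd |].
  unfold lhs_a; rewrite (cderiv_unique _ _ _ Hd), phi_RL_sq, <- E; ring.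
- rewrite CQ_0; field; apply RtoC_neq0; lra.
- destruct (Qr_near_m1 (2 / 3 * beta)) as [x [Hx HQ]]; [lra |].
  apply not_subordinate_phi_Ne with x (1 + Qr x / beta); [lra | |].
  + rewrite CQ_real, RtoC_plus, RtoC_div by lra; reflexivity.
  + left; assert (Qr x / beta <= - (2 / 3)) by (apply <- Rle_div_l; lra); lra.
Qed.

Lemma sharp_b (b : R) : b < beta_b -> ~ sufficient_from lhs_b b.
Proof.
rewrite beta_b_eq; intros Hb.
assert (Hq := qpos_pos); assert (Hln := ln_53_bounds).
assert (Hb0 : 0 < qpos / ln (5 / 3)) by (apply Rdiv_lt_0_compat; lra).
apply not_sufficient with (fun beta z => Cexp (CQ z / beta)) (qpos / ln (5 / 3));
  [exact Hb0 | exact Hb |].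
intros beta Hbeta; repeat split.
- intros z Hz; destruct (cderiv_CQ_div beta z (ltac:(lra)) Hz) as [l [Hl E]].
  assert (Hd : cderiv (fun z => Cexp (CQ z / beta)) z (Cexp (CQ z / beta) * l)%C)
    by (apply (cderiv_comp Cexp (fun z => CQ z / beta)%C); [apply cderiv_Cexp | exact Hl]).
  eexists; split; [exact Hd |].
  unfold lhs_b; rewrite (cderiv_unique _ _ _ Hd), phi_RL_sq, <- E; field; apply Cexp_neq0.
- rewrite CQ_0; replace (0 / beta)%C with (RtoC 0) by (field; apply RtoC_neq0; lra).
  unfold Cexp, RtoC; simpl; rewrite exp_0, cos_0, sin_0; f_equal; ring.
- assert (Hm : beta * ln (5 / 3) < qpos) by (apply Rlt_div_r; lra).
  destruct (Qr_near_1 _ Hm) as [x [Hx HQ]].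
  apply not_subordinate_phi_Ne with x (exp (Qr x / beta)); [lra | |].
  + rewrite CQ_real, <- RtoC_div by lra.
    unfold Cexp, RtoC; simpl; rewrite cos_0, sin_0; f_equal; ring.
  + right; rewrite <- (exp_ln (5 / 3)) by lra; apply Rlt_le, exp_increasing.
    apply -> Rlt_div_r; lra.
Qed.

Lemma sharp_c (b : R) : b < beta_c -> ~ sufficient_from lhs_c b.
Proof.
rewrite beta_c_eq; intros Hb.
assert (Hq := qpos_pos).
apply not_sufficient with (fun beta z => / (1 - CQ z / beta))%C (5 / 2 * qpos); [lra | exact Hb |].
intros beta Hbeta.
assert (Hqb : qpos / beta < 1) by (apply <- Rlt_div_l; lra).
repeat split.
- intros z Hz; destruct (cderiv_CQ_div beta z (ltac:(lra)) Hz) as [l [Hl E]].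
  assert (Hn : (1 - CQ z / beta)%C <> 0%C).
  (* The disc estimate is applied to the extremal function itself, with identity Schwarz function:
     Re (CQ z / beta) stays below qpos / beta < 1, so the denominator has no zero. *)
  { destruct (radial_disc (fun z => CQ z / beta)%C (fun z => z) beta z) as [X [Y [HX [HY Hd]]]];
      [lra | exact Hz | intros; lra | | |].
    - rewrite CQ_0; field; apply RtoC_neq0; lra.
    - intros t Ht; apply (cderiv_CQ_div beta); [lra | apply ray_in_disk; assumption].
    - assert (A := in_disc_range X Y _ (proj1 HX) (proj1 HY) Hd).
      apply Cneq0_Re; unfold Cminus; rewrite re_plus, re_opp, re_RtoC; lra. }
  assert (Hd : cderiv (fun z => / (1 - CQ z / beta))%C z
    (- (0 - l) / ((1 - CQ z / beta) * (1 - CQ z / beta)))%C).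
  { apply (cderiv_inv (fun z => 1 - CQ z / beta)%C); [exact Hn |].
    apply cderiv_minus; [apply cderiv_const | exact Hl]. }
  eexists; split; [exact Hd |].
  unfold lhs_c; rewrite (cderiv_unique _ _ _ Hd), phi_RL_sq, <- E.
  generalize (1 - CQ z / beta)%C Hn; intros u Hu; field; exact Hu.
- rewrite CQ_0; replace (1 - 0 / beta)%C with (RtoC 1) by (field; apply RtoC_neq0; lra).
  field; exact C1_nz.
- destruct (Qr_near_1 (2 / 5 * beta)) as [x [Hx HQ]]; [lra |].
  assert (H1 := Qr_range_pos x (ltac:(lra))).
  assert (H2 : 2 / 5 < Qr x / beta) by (apply -> Rlt_div_r; lra).
  assert (H3 : Qr x / beta < 1) by (apply <- Rlt_div_l; [| lra]; apply Rlt_div_l in Hqb; lra).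
  apply not_subordinate_phi_Ne with x (/ (1 - Qr x / beta)); [lra | |].
  + rewrite CQ_real, RtoC_inv, RtoC_minus, RtoC_div by lra; reflexivity.
  + right; rewrite <- Rdiv_1_l; apply -> Rle_div_r; lra.
Qed.

Theorem theorem2p2 :
  (sufficient_from lhs_a beta_a /\
   sufficient_from lhs_b beta_b /\
   sufficient_from lhs_c beta_c) /\
  ((forall b : R, (b < beta_a)%R -> ~ sufficient_from lhs_a b) /\
   (forall b : R, (b < beta_b)%R -> ~ sufficient_from lhs_b b) /\
   (forall b : R, (b < beta_c)%R -> ~ sufficient_from lhs_c b)).
Proof.
exact (conj (conj sufficient_a (conj sufficient_b sufficient_c))
  (conj sharp_a (conj sharp_b sharp_c))).
Qed.
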